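(* Let $\Phi=\{\varphi_i\}_{i=1}^M$ be a unit norm frame for $\mathbb{R}^N$ and assume that $d_\Phi<1$. Then with $K:=\min\{M,\tfrac{N(N+1)}{2}\}$ and $\omega:=D_\Phi+\sqrt{K}$ we have $$\frac{D_\Phi}{\omega+\sqrt{\omega^2-D_\Phi^2}}\le d_\Phi\le\sqrt{KN\left(1-V_\Phi^{2/N}\right)}.$$ Consequently, with the help of the inequalities between $D_\Phi$ and $V_\Phi$ recalled in the context, we can bound $d_\Phi$ below and above by expressions of $D_\Phi$ or expressions of $V_\Phi$.
   Context: A sequence $\Phi=\{\varphi_i\}_{i=1}^M\subset\mathbb{R}^N$ is identified with the $N\times M$ matrix with columns $\varphi_i$. It is a frame if there are $0<A\le B<\infty$ with $A\|x\|^2\le\sum_{i=1}^M|\langle x,\varphi_i\rangle|^2\le B\|x\|^2$ for all $x\in\mathbb{R}^N$; tight if one may take $A=B$; unit norm if $\|\varphi_i\|_2=1$ for all $i$. A frame $\{\psi_i\}_{i=1}^M$ (not necessarily unit norm) is scalable if there exist nonnegative scalars $s_i$ such that $\{s_i\psi_i\}_{i=1}^M$ is a tight frame for $\mathbb{R}^N$; the set of scalable frames of $M$ vectors in $\mathbb{R}^N$ is denoted $\mathcal{SC}(M,N)$. For a unit norm frame $\Phi$ (with $\|\cdot\|_F$ the Frobenius norm): - $d_\Phi=\inf_{\Psi\in\mathcal{SC}(M,N)}\|\Phi-\Psi\|_F$; - $D_\Phi=\min_{c_1,\dots,c_M\ge0}\big\|\sum_{i=1}^Mc_i\varphi_i\varphi_i^T-I\big\|_F$;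 - $V_\Phi=\mathrm{Vol}(E_\Phi)/\omega_N$, where $\omega_N$ is the volume of the unit ball in $\mathbb{R}^N$ and $E_\Phi$ is the minimal ellipsoid of $\Phi$, i.e. the unique ellipsoid of minimal volume containing the convex hull of $\{\varphi_i\}_{i=1}^M\cup\{-\varphi_i\}_{i=1}^M$ (an ellipsoid being a set $\{v:\langle X(v-c),v-c\rangle\le1\}$ with $X$ positive definite, $c\in\mathbb{R}^N$). The previously established inequalities between $D_\Phi$ and $V_\Phi$, used for the final assertion, are: for every unit norm frame $\Phi$ of $M$ vectors in $\mathbb{R}^N$, $$\frac{N(1-D_\Phi^2)}{N-D_\Phi^2}\le V_\Phi^{4/N}\le\frac{N(N-1-D_\Phi^2)}{(N-1)(N-D_\Phi^2)}\le1,$$ where the leftmost inequality requires $D_\Phi<1$. *)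

(* Defs.v *)
From HB Require Import structures.
From mathcomp Require Import all_boot all_order all_algebra.
From mathcomp Require Import all_classical all_reals all_analysis.

Set Implicit Arguments.
Unset Strict Implicit.
Unset Printing Implicit Defensive.

Import Order.TTheory GRing.Theory Num.Theory.
Import numFieldNormedType.Exports.

Local Open Scope classical_set_scope.
Local Open Scope ring_scope.

(* The norm `|_| that the library puts on matrices is the sup norm, hence the
   explicit Euclidean and Frobenius norms. *)
Definition dotv (R : realType) (n : nat) (x y : 'cV[R]_n) : R :=
  \sum_(i < n) x i 0 * y i 0.

Definition norm2 (R : realType) (n : nat) (x : 'cV[R]_n) : R :=
  Num.sqrt (dotv x x).

Definition normF (R : realType) (m n : nat) (A : 'M[R]_(m, n)) : R :=
  Num.sqrt (\sum_(i < m) \sum_(j < n) A i j ^+ 2).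

(* The sequence (phi_i)_{i < M} in R^N is the N x M matrix Phi with
   phi_i = col i Phi. *)
Definition frame_bounds (R : realType) (N M : nat) (Phi : 'M[R]_(N, M))
    (A B : R) : Prop :=
  forall x : 'cV[R]_N,
    A * norm2 x ^+ 2 <= \sum_(i < M) `|dotv x (col i Phi)| ^+ 2 /\
    \sum_(i < M) `|dotv x (col i Phi)| ^+ 2 <= B * norm2 x ^+ 2.

Definition is_frame (R : realType) (N M : nat) (Phi : 'M[R]_(N, M)) : Prop :=
  exists A B : R, [/\ 0 < A, A <= B & frame_bounds Phi A B].

Definition tight_frame (R : realType) (N M : nat) (Phi : 'M[R]_(N, M)) : Prop :=
  exists A : R, 0 < A /\ frame_bounds Phi A A.

Definition unit_norm (R : realType) (N M : nat) (Phi : 'M[R]_(N, M)) : Prop :=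
  forall i : 'I_M, norm2 (col i Phi) = 1.

Definition scalable_frames (R : realType) (M N : nat) : set 'M[R]_(N, M) :=
  [set Psi | is_frame Psi /\
     exists s : 'I_M -> R, (forall i, 0 <= s i) /\
       tight_frame (\matrix_(k < N, i < M) (s i * Psi k i))].

(* In the next definition the set is nonempty as soon as Phi is a frame, since
   then N <= M; it is always bounded below by 0. *)
Definition dist_scalable (R : realType) (N M : nat) (Phi : 'M[R]_(N, M)) : R :=
  inf [set normF (Phi - Psi) | Psi in @scalable_frames R M N].

(* This infimum is a minimum: it is the distance from the identity to a
   finitely generated, hence closed, convex cone. *)
Definition dist_identity (R : realType) (N M : nat) (Phi : 'M[R]_(N, M)) : R :=
  inf [set normF (\sum_(i < M) c i *: (col i Phi *m (col i Phi)^T) - 1%:M)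
      | c in [set c : 'I_M -> R | forall i, 0 <= c i]].

(* The n-fold product of the one-dimensional Lebesgue measure. Each step is the
   formula defining product_measure1: integrate the volume of the sections at a
   fixed first coordinate. Meaningful on Borel sets only; it is applied below
   to closed ellipsoids. *)
Fixpoint volume (R : realType) (n : nat) : set 'cV[R]_n -> \bar R :=
  match n return set 'cV[R]_n -> \bar R with
  | 0%N => fun A => (\1_A (0 : 'cV[R]_0))%:E
  | m.+1 => fun A =>
      (\int[@lebesgue_measure R]_(x in setT)
         volume [set v : 'cV[R]_m | A (col_mx (x%:M : 'cV[R]_1) v)])%E
  end.

Definition posdef (R : realType) (n : nat) (X : 'M[R]_n) : Prop :=
  X^T = X /\ forall v : 'cV[R]_n, v != 0 -> 0 < dotv (X *m v) v.

Definition is_ellipsoid (R : realType) (n : nat) (E : set 'cV[R]_n) : Prop :=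
  exists (X : 'M[R]_n) (c : 'cV[R]_n),
    posdef X /\ E = [set v | dotv (X *m (v - c)) (v - c) <= 1].

Definition convex_hull (R : realType) (n : nat) (A : set 'cV[R]_n) :
  set 'cV[R]_n := smallest (@convex_set R 'cV[R]_n) A.

Definition pm_columns (R : realType) (N M : nat) (Phi : 'M[R]_(N, M)) :
    set 'cV[R]_N :=
  [set col i Phi | i in [set: 'I_M]] `|` [set - col i Phi | i in [set: 'I_M]].

Definition is_minimal_ellipsoid (R : realType) (N M : nat)
    (Phi : 'M[R]_(N, M)) (E : set 'cV[R]_N) : Prop :=
  [/\ is_ellipsoid E, convex_hull (pm_columns Phi) `<=` E &
      forall E' : set 'cV[R]_N, is_ellipsoid E' ->
        convex_hull (pm_columns Phi) `<=` E' -> (volume E <= volume E')%E].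

(* The default set0 is irrelevant for a frame Phi, which has exactly one
   minimal ellipsoid. *)
Definition minimal_ellipsoid (R : realType) (N M : nat) (Phi : 'M[R]_(N, M)) :
  set 'cV[R]_N := xget set0 [set E | is_minimal_ellipsoid Phi E].

Definition unit_ball (R : realType) (N : nat) : set 'cV[R]_N :=
  [set v | norm2 v <= 1].

Definition ellipsoid_ratio (R : realType) (N M : nat) (Phi : 'M[R]_(N, M)) : R :=
  fine (volume (minimal_ellipsoid Phi)) / fine (volume (@unit_ball R N)).

(* Main.v *)
Require Import Defs.
From mathcomp Require Import all_boot all_order all_algebra perm complex.
From mathcomp Require Import all_classical all_reals all_analysis measurable_realfun.
From mathcomp Require Import ring lra.

(** The whole proof runs through one optimization problem on the side of the
    frame vectors. For weights c >= 0 write frame_op Phi c for the positive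
    semidefinite matrix sum_i c_i phi_i phi_i^T, and let P = frame_op Phi c maximize
    the determinant among weights of total mass N. Moving mass towards one
    vector phi_k cannot increase the determinant, which forces
    <P^-1 phi_k, phi_k> <= 1 for all k. Hence {v : <P^-1 v, v> <= 1} contains the
    vectors +-phi_i, and it is a minimal ellipsoid: if X' defines another
    ellipsoid around them, the symmetry of the set of vectors allows one to
    move its center to 0, then tr (X' P) <= N, and the arithmetic-geometric mean
    inequality gives det X' det P <= 1. The volume of an ellipsoid is computed
    by slicing along the first coordinate, a Schur complement giving each slice
    as an ellipsoid of one dimension less; so V = sqrt (det P), and
    g := V^(2/N) satisfies g^N = det P, while V^(4/N) = g^2.

    Since tr P = N, comparing total masses shows that the weights live on
    contact points, those with <P^-1 phi_i, phi_i> = 1, and by Caratheodory's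
    theorem for cones at most K of them are needed without changing P.

    Upper bound ([scalable_near]). Replacing phi_i by P^(-1/2) phi_i on the support
    of the weights makes the weighted sum of outer products equal to the identity,
    hence a scalable frame. In an eigenbasis of P, with eigenvalues mu_k^2,
    the square of the displacement of a contact point is a convex combination
    of the numbers (mu_k - 1)^2. As the mu_k^2 sum to N, each of them is at
    most N (1 - g), by a refined arithmetic-geometric mean inequality
    ([AMGM_gap]). Adding up at most K such displacements gives
    d <= sqrt (K N (1 - g)).

    Lower bound ([dist_identity_scalable]). A scalable frame Psi at distance
    e < 1 from Phi satisfies frame_op Psi c = I for weights c supported by at most K
    indices; c_i |psi_i|^2 <= 1 and |psi_i| >= 1 - e. Using the same weights for
    Phi bounds D (1 - e)^2 by 2 e sqrt K, and this inequality is equivalent to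
    the announced fraction being at most e ([lower_fraction_le]).

    Comparison of D and V ([det_bound_of_identity_gap]). If Q = frame_op Phi b is at
    distance e < 1 from the identity, then tr (P^-1 Q) <= tr Q because
    <P^-1 phi_i, phi_i> <= 1. The Cauchy-Schwarz inequality for the traceless
    parts of P^-1 and Q, together with Maclaurin's inequality between the second
    elementary symmetric function of the eigenvalues of P^-1 and their geometric
    mean 1/g, yields N (1 - e^2) <= g^2 (N - e^2). This says delta <= e, so
    delta <= D, and the remaining two bounds follow by monotonicity. *)

Set Implicit Arguments.
Unset Strict Implicit.
Unset Printing Implicit Defensive.

Import Order.TTheory GRing.Theory Num.Theory.
Import numFieldNormedType.Exports.

Local Open Scope classical_set_scope.
Local Open Scope ring_scope.

(** * Spectral theorem for real symmetric matrices *)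

(** Over R[i] the matrix is Hermitian, so its spectral diagonal is real, and a real
    root of the characteristic polynomial is an eigenvalue over R. *)
Lemma sym_eigenvalue (R : rcfType) (n : nat) (A : 'M[R]_n.+1) :
  A^T = A -> exists a : R, eigenvalue A a.
Proof.
move=> Asym; pose C : numClosedFieldType := complex.complex R.
pose toC : {rmorphism R -> C} := complex.real_complex_def (Phant R).
have Aherm : map_mx toC A \is hermsymmx.
  apply/is_hermitianmxP; rewrite expr0 scale1r map_trmx.
  rewrite -map_mx_comp Asym; apply/matrixP => i j; rewrite !mxE.
  by apply/esym; rewrite -[LHS]/(complex.conjc _) complex.conjc_real.
have /hermitian_normalmx /orthomx_spectralP := Aherm.
set sp := spectral_diag _; set Q := spectralmx _ => Aeq.
have := hermitian_spectral_diag_real Aherm.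
move=> /mxOverP /(_ 0 0); rewrite -/sp => sp_real.
have Qu : Q \in unitmx by apply: spectral_unit.
have : eigenvalue (map_mx toC A) (sp 0 0).
  apply/eigenvalueP; exists (row 0 Q); last first.
    apply/eqP => /(congr1 (mulmx^~ (invmx Q))).
    rewrite -row_mul mulmxV// mul0mx => /rowP/(_ 0).
    by rewrite row1 !mxE eqxx => /eqP; rewrite oner_eq0.
  rewrite Aeq -row_mul !mulmxA mulmxV// mul1mx.
  by rewrite row_mul row_diag_mx -scalemxAl -rowE.
rewrite eigenvalue_root_char -map_char_poly.
have [a ->] : exists a : R, sp 0 0 = toC a.
  exists (complex.Re (sp 0 0)); apply/esym.
  by have := complex.RRe_real sp_real.
by rewrite fmorph_root => ra; exists a; rewrite eigenvalue_root_char.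
Qed.

(** The reflection exchanging v and the first basis vector e: with w := e - v it
    is 1 - 2 w^T w / |w|^2, where |w|^2 = 2 (1 - v_0). *)
Lemma householder (R : rcfType) (n : nat) (v : 'rV[R]_n.+1) :
  v *m v^T = 1%:M ->
  exists H : 'M[R]_n.+1, [/\ H^T = H, H *m H = 1%:M & row 0 H = v].
Proof.
move=> v1; pose e : 'rV[R]_n.+1 := delta_mx 0 0; pose w := e - v.
have [w0|w_neq0] := eqVneq w 0.
  exists 1%:M; rewrite trmx1 mulmx1; split => //.
  by rewrite row1; apply/eqP; rewrite -subr_eq0 -/e -/w w0.
have ee : e *m e^T = 1%:M.
  by rewrite trmx_delta mul_delta_mx; apply/matrixP => i j; rewrite !ord1 !mxE.
have ve : v *m e^T = (v 0 0)%:M.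
  rewrite trmx_delta -colE; apply/matrixP => i j; rewrite !ord1 !mxE.
  by rewrite eqxx mulr1n.
have ev : e *m v^T = (v 0 0)%:M.
  by rewrite -[LHS]trmxK trmx_mul trmxK ve tr_scalar_mx.
have ww : w *m w^T = (2 * (1 - v 0 0))%:M.
  rewrite /w linearB/= mulmxBl !mulmxBr ee ev ve v1 -!rmorphB/=.
  by congr (_%:M); ring.
have k0 : 1 - v 0 0 != 0.
  apply: contraNneq w_neq0 => v00; move: ww; rewrite v00 mulr0.
  move=> /matrixP/(_ 0 0); rewrite !mxE mulr1n => /eqP.
  rewrite psumr_eq0 => [/allP w0|i _]; last by rewrite !mxE -expr2 sqr_ge0.
  apply/eqP/rowP => i; have /(_ (mem_index_enum i)) := w0 i.
  by rewrite !mxE -expr2 sqrf_eq0 => /eqP.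
pose k := 1 - v 0 0.
have ew : e *m w^T = k%:M by rewrite /w linearB/= mulmxBr ee ev -rmorphB.
have vE : v = e - w by rewrite /w opprB addrC subrK.
clearbody w; exists (1%:M - k^-1 *: (w^T *m w)); split.
- by rewrite linearB/= trmx1 linearZ/= trmx_mul trmxK.
- rewrite mulmxBl mul1mx mulmxBr mulmx1 -scalemxAl -scalemxAr !mulmxA.
  rewrite -(mulmxA _ w) ww mul_mx_scalar -scalemxAl !scalerA.
  rewrite -/k (_ : _ * _ = 2 * k^-1); last by field.
  rewrite mulr2n mulrDl mul1r scalerDl.
  by rewrite opprB addrK subrK.
- rewrite rowE -/e mulmxBr mulmx1 -scalemxAr mulmxA.
  by rewrite ew mul_scalar_mx scalerA mulVf// scale1r.
Qed.

(** A reflection carrying the first basis vector to a unit eigenvector makes the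
    first row a multiple of that basis vector, hence by symmetry the first column
    as well; the remaining block is smaller. *)
Lemma spectral_theorem (R : rcfType) (n : nat) (A : 'M[R]_n) : A^T = A ->
  exists (O : 'M[R]_n) (d : 'rV[R]_n),
    O *m O^T = 1%:M /\ A = O^T *m diag_mx d *m O.
Proof.
elim: n A => [|n IH] A Asym.
  by exists 1%:M, 0; split; apply/matrixP => -[].
have [a /eigenvalueP[v vA v0]] := sym_eigenvalue Asym.
have vv0 : 0 < (v *m v^T) 0 0.
  rewrite !mxE; under eq_bigr do rewrite !mxE -expr2.
  rewrite lt_def sumr_ge0 ?andbT; last by move=> i _; exact: sqr_ge0.
  apply: contraNneq v0 => /eqP; rewrite psumr_eq0.
    move=> /allP vi0; apply/eqP/rowP => i; have /(_ (mem_index_enum i)) := vi0 i.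
    by rewrite !mxE sqrf_eq0 => /eqP.
  by move=> i _; exact: sqr_ge0.
pose u := (Num.sqrt ((v *m v^T) 0 0))^-1 *: v.
have uA : u *m A = a *: u by rewrite -scalemxAl vA !scalerA mulrC.
have uu : u *m u^T = 1%:M.
  rewrite /u linearZ/= -scalemxAl -scalemxAr scalerA -invfM -expr2.
  rewrite sqr_sqrtr ?ltW// [X in _ *: X]mx11_scalar scale_scalar_mx.
  by rewrite mulVf ?gt_eqF.
have [H [Hsym HH Hu]] := householder uu.
pose B : 'M[R]_(1 + n) := H *m A *m H.
have Bsym : B^T = B by rewrite !trmx_mul Hsym Asym mulmxA.
have rB : row 0 B = a *: delta_mx 0 0.
  rewrite row_mul row_mul Hu uA -scalemxAl; congr (_ *: _).
  by rewrite -Hu -row_mul HH row1.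
have AE : A = H *m B *m H.
  by rewrite /B !mulmxA HH mul1mx -mulmxA HH mulmx1.
clearbody B.
have Bur : ursubmx B = 0.
  apply/matrixP => i j; rewrite !ord1 !mxE -[LHS](_ : row 0 B 0 (rshift 1 j) = _).
    by rewrite rB !mxE mulr0.
  by rewrite mxE; congr (B _ _); apply/val_inj.
have Bul : ulsubmx B = a%:M.
  apply/matrixP => i j; rewrite !ord1 !mxE -[LHS](_ : row 0 B 0 (lshift n 0) = _).
    by rewrite rB !mxE mulr1 mulr1n.
  by rewrite mxE; congr (B _ _); apply/val_inj.
have Bdl : dlsubmx B = 0.
  by rewrite -[dlsubmx B]trmxK trmx_dlsub Bsym Bur trmx0.
have [U [d [UU dB]]] : exists (U : 'M[R]_n) (d : 'rV[R]_n),
    U *m U^T = 1%:M /\ drsubmx B = U^T *m diag_mx d *m U.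
  by apply: IH; rewrite trmx_drsub Bsym.
have BE : B = block_mx a%:M 0 0 (drsubmx B).
  by rewrite -[LHS]submxK Bur Bul Bdl.
pose W : 'M[R]_(1 + n) := block_mx 1%:M 0 0 U.
have WT : W^T = block_mx 1%:M 0 0 U^T.
  by rewrite /W tr_block_mx trmx1 !trmx0.
have WW : W *m W^T = 1%:M.
  rewrite WT /W mulmx_block !mulmx0 !mul0mx !mulmx1 !addr0 !add0r UU.
  by rewrite -scalar_mx_block.
have BW : B = W^T *m diag_mx (row_mx a%:M d) *m W.
  rewrite BE dB WT diag_mx_row /W.
  have -> : diag_mx (a%:M : 'rV[R]_1) = a%:M.
    by apply/matrixP => i j; rewrite !ord1 !mxE.
  by rewrite !mulmx_block !(mulmx0, mul0mx, mulmx1, mul1mx, addr0, add0r).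
exists (W *m H), (row_mx a%:M d); split.
  by rewrite trmx_mul Hsym -mulmxA (mulmxA H) HH mul1mx.
by rewrite AE BW trmx_mul Hsym !mulmxA.
Qed.

(** * Refinements of the arithmetic-geometric mean inequality *)

Lemma geo_mean_le_sum (R : realFieldType) (I : finType) (x : I -> R) (g : R) :
  (forall i, 0 <= x i) -> 0 <= g -> g ^+ #|I| = \prod_i x i ->
  #|I|%:R * g <= \sum_i x i.
Proof.
move=> x0 g0 gx; have [I0|I0] := posnP #|I|.
  by rewrite I0 mul0r sumr_ge0.
have /= [+ _] := @leif_AGM R I [pred i | true] x (fun i _ => x0 i).
rewrite -gx cardT -cardE ler_pXn2r// ?nnegrE ?divr_ge0 ?sumr_ge0//.
by rewrite ler_pdivlMr ?ltr0n// mulrC.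
Qed.

(** Maclaurin's inequality for the second elementary symmetric function: the
    arithmetic-geometric mean inequality for the n (n - 1) products x_i x_j
    with i <> j, each x_i occurring 2 (n - 1) times in their product. *)
Lemma geo_mean_sq_le_pairs (R : realFieldType) (n : nat) (x : 'I_n -> R) (g : R) :
  (forall i, 0 <= x i) -> 0 <= g -> g ^+ n = \prod_i x i ->
  n%:R * (n%:R - 1) * g ^+ 2 <= (\sum_i x i) ^+ 2 - \sum_i x i ^+ 2.
Proof.
case: n x => [|n] x x0 g0 gx; first by rewrite !mul0r !big_ord0 expr0n subrr.
pose P := [pred p : 'I_n.+1 * 'I_n.+1 | p.1 != p.2].
have cardP : #|P| = (n.+1 * n)%N.
  have rowE (i : 'I_n.+1) : (\sum_(j | i != j) 1 = n)%N.
    rewrite sum1_card (eq_card (B := predC1 i)); first by rewrite cardC1 card_ord.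
    by move=> j; rewrite !inE eq_sym.
  rewrite -sum1_card -(pair_big_dep xpredT (fun i j => i != j) (fun _ _ => 1%N))/=.
  by under eq_bigr do rewrite rowE; rewrite sum_nat_const card_ord.
have prodP : \prod_(p in P) (x p.1 * x p.2) = g ^+ 2 ^+ #|P|.
  rewrite cardP big_split/=.
  have E : \prod_(p in P) x p.1 = \prod_i x i ^+ n.
    rewrite -(pair_big_dep xpredT (fun i j => i != j) (fun i _ => x i))/=.
    apply: eq_bigr => i _; rewrite prodr_const (eq_card (B := predC1 i)).
      by rewrite cardC1 card_ord.
    by move=> j; rewrite !inE eq_sym.
  have -> : \prod_(p in P) x p.2 = \prod_(p in P) x p.1.
    rewrite (reindex (fun p : 'I_n.+1 * 'I_n.+1 => (p.2, p.1))).
      by apply: eq_bigl => -[i j]; rewrite !inE/= eq_sym.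
    by exists (fun p => (p.2, p.1)) => -[].
  rewrite E prodrXl -gx -!exprM -exprD; congr (_ ^+ _).
  by rewrite mul2n -addnn.
have sumP : \sum_(p in P) x p.1 * x p.2 = (\sum_i x i) ^+ 2 - \sum_i x i ^+ 2.
  rewrite expr2 big_distrlr/=.
  rewrite -(pair_big_dep xpredT (fun i j => i != j) (fun i j => x i * x j))/=.
  rewrite -sumrB; apply: eq_bigr => i _.
  rewrite [in RHS](bigD1 i)//= expr2 [RHS]addrC addKr.
  by apply: eq_bigl => j; rewrite eq_sym.
have /= [+ _] := @leif_AGM R _ P (fun p => x p.1 * x p.2)
  (fun p _ => mulr_ge0 (x0 p.1) (x0 p.2)).
rewrite prodP sumP cardP; case: n => [|n] in x x0 gx P cardP prodP sumP *.
  move=> _; rewrite subrr mulr0 mul0r !big_ord_recl !big_ord0 !addr0.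
  by rewrite subrr.
have S0 : 0 <= (\sum_i x i) ^+ 2 - \sum_i x i ^+ 2.
  by rewrite -sumP sumr_ge0// => p _; rewrite mulr_ge0.
rewrite ler_pXn2r ?nnegrE ?divr_ge0 ?sqr_ge0 ?muln_gt0//.
rewrite ler_pdivlMr ?ltr0n ?muln_gt0// natrM mulrC.
by rewrite -[n.+2%:R - 1](_ : n.+1%:R = _)// [in RHS]mulrS addrAC subrr add0r.
Qed.

(** Replacing both m_a^2 and m_b^2 by m_a m_b keeps the product and lowers the sum
    by (m_a - m_b)^2, so this much room is left in the arithmetic-geometric mean
    inequality. *)
Lemma AMGM_gap (R : realFieldType) (n : nat) (m : 'I_n -> R) (g : R) (a b : 'I_n) :
  (forall i, 0 <= m i) -> 0 <= g -> g ^+ n = \prod_i m i ^+ 2 ->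
  (m a - m b) ^+ 2 <= \sum_i m i ^+ 2 - n%:R * g.
Proof.
move=> m0 g0 gm.
have [->|ab] := eqVneq a b.
  rewrite subrr expr0n/= subr_ge0 -[n in n%:R]card_ord.
  by apply: geo_mean_le_sum => //; [move=> i; exact: sqr_ge0|rewrite card_ord].
pose y i := if (i == a) || (i == b) then m a * m b else m i ^+ 2.
have := @geo_mean_le_sum R 'I_n y g.
rewrite card_ord => /(_ _ g0) H.
have {H} : n%:R * g <= \sum_i y i.
  apply: H => [i|].
    by rewrite /y; case: ifP => _; rewrite ?mulr_ge0 ?sqr_ge0.
  rewrite gm (bigD1 a)//= (bigD1 b)/= 1?eq_sym//.
  rewrite [RHS](bigD1 a)//= [in RHS](bigD1 b)/= 1?eq_sym//.
  rewrite {1 2}/y !eqxx orbT/= !mulrA; congr (_ * _); first by ring.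
  by apply: eq_bigr => i /andP[/negbTE ia /negbTE ib]; rewrite /y ia ib.
rewrite (bigD1 a)//= (bigD1 b)/= 1?eq_sym//.
rewrite [\sum_i m i ^+ 2](bigD1 a)//=.
rewrite [\sum_(i | _ != _) m i ^+ 2](bigD1 b)/= 1?eq_sym//.
rewrite {1 2}/y !eqxx orbT/= (eq_bigr (fun i => m i ^+ 2)); first by lra.
by move=> i /andP[/negbTE ia /negbTE ib]; rewrite /y ia ib.
Qed.

(** As the squares have mean 1, some m_b lies on the other side of 1 than m_k, and
    then |m_k - 1| <= |m_k - m_b|. *)
Lemma AMGM_gap1 (R : realFieldType) (n : nat) (m : 'I_n -> R) (g : R) (k : 'I_n) :
  (forall i, 0 <= m i) -> 0 <= g -> g ^+ n = \prod_i m i ^+ 2 ->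
  \sum_i m i ^+ 2 = n%:R ->
  (m k - 1) ^+ 2 <= n%:R * (1 - g).
Proof.
move=> m0 g0 gm sm; rewrite mulrBr mulr1 -{1}sm.
suff [b mb] : exists b, (m k - 1) * (m b - 1) <= 0.
  have := AMGM_gap k b m0 g0 gm.
  by apply: le_trans; have := sqr_ge0 (m b - 1); nra.
apply/not_existsP => H.
have {}H i : 0 < (m k - 1) * (m i - 1) by rewrite ltNge; apply/negP/H.
have [mk|mk] := leP (m k) 1.
- suff : \sum_i m i ^+ 2 < \sum_(i < n) 1.
    by rewrite sm sumr_const card_ord ltxx.
  apply: ltr_sum => [|i _]; first by apply/hasP; exists k; rewrite ?mem_index_enum.
  by have := H i; have := m0 i; nra.
- suff : \sum_(i < n) 1 < \sum_i m i ^+ 2.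
    by rewrite sm sumr_const card_ord ltxx.
  apply: ltr_sum => [|i _]; first by apply/hasP; exists k; rewrite ?mem_index_enum.
  by have := H i; have := m0 i; nra.
Qed.

(** * Euclidean products and positive semidefinite matrices *)

Lemma dotvE (R : realType) n (x y : 'cV[R]_n) : dotv x y = (x^T *m y) 0 0.
Proof. by rewrite !mxE; apply: eq_bigr => i _; rewrite !mxE. Qed.

Section Dot.
Variables (R : realType) (n : nat).
Implicit Types (x y z : 'cV[R]_n) (A : 'M[R]_n).

Lemma dotvC x y : dotv x y = dotv y x.
Proof. by apply: eq_bigr => i _; rewrite mulrC. Qed.

Lemma dotvDl x y z : dotv (x + y) z = dotv x z + dotv y z.
Proof. by rewrite -big_split; apply: eq_bigr => i _; rewrite mxE mulrDl. Qed.

Lemma dotvZl a x y : dotv (a *: x) y = a * dotv x y.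
Proof. by rewrite mulr_sumr; apply: eq_bigr => i _; rewrite mxE mulrA. Qed.

Lemma dotvDr x y z : dotv z (x + y) = dotv z x + dotv z y.
Proof. by rewrite dotvC dotvDl !(dotvC z). Qed.

Lemma dotvZr a x y : dotv x (a *: y) = a * dotv x y.
Proof. by rewrite dotvC dotvZl dotvC. Qed.

Lemma dotvNl x y : dotv (- x) y = - dotv x y.
Proof. by rewrite -scaleN1r dotvZl mulN1r. Qed.

Lemma dotvNr x y : dotv x (- y) = - dotv x y.
Proof. by rewrite dotvC dotvNl dotvC. Qed.

Lemma dotv0r x : dotv x 0 = 0.
Proof. by rewrite -(scale0r 0) dotvZr mul0r. Qed.

Lemma dotv_ge0 x : 0 <= dotv x x.
Proof. by apply: sumr_ge0 => i _; rewrite -expr2 sqr_ge0. Qed.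

Lemma dotv_eq0 x : (dotv x x == 0) = (x == 0).
Proof.
apply/eqP/eqP => [|->]; last by apply: big1 => i _; rewrite mxE mul0r.
move=> /eqP; rewrite psumr_eq0 => [/allP x0|i _]; last by rewrite -expr2 sqr_ge0.
apply/colP => i; have /(_ (mem_index_enum i)) := x0 i.
by rewrite mxE -expr2 sqrf_eq0 => /eqP.
Qed.

Lemma norm2_sqr x : norm2 x ^+ 2 = dotv x x.
Proof. by rewrite sqr_sqrtr// dotv_ge0. Qed.

Lemma norm2_ge0 x : 0 <= norm2 x.
Proof. exact: sqrtr_ge0. Qed.

Lemma dotv_trmx m (B : 'M[R]_(m, n)) x (y : 'cV[R]_m) :
  dotv (B *m x) y = dotv x (B^T *m y).
Proof. by rewrite !dotvE trmx_mul mulmxA. Qed.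

Lemma quad_trace A x : dotv (A *m x) x = \tr (A *m (x *m x^T)).
Proof. by rewrite dotvC dotvE [in RHS]mulmxA [in RHS]mxtrace_mulC trace_mx11. Qed.

Lemma cauchy_schwarz x y : dotv x y ^+ 2 <= dotv x x * dotv y y.
Proof.
have [y0|y0] := eqVneq (dotv y y) 0.
  move/eqP: (y0); rewrite dotv_eq0 => /eqP ->.
  by rewrite !dotv0r expr0n mulr0.
have yy : 0 < dotv y y by rewrite lt_def y0 dotv_ge0.
have := dotv_ge0 (dotv y y *: x - dotv x y *: y).
rewrite dotvDl !dotvDr !dotvNl !dotvNr !dotvZl !dotvZr (dotvC y x).
set a := dotv x x; set b := dotv x y; set c := dotv y y in y0 yy *.
rewrite [leRHS](_ : _ = c * (a * c - b ^+ 2)); last by ring.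
by rewrite pmulr_rge0// subr_ge0.
Qed.

End Dot.

Section Psd.
Variable R : realType.

Definition psd n (A : 'M[R]_n) : Prop :=
  A^T = A /\ forall v : 'cV[R]_n, 0 <= dotv (A *m v) v.

Lemma posdef_psd n (A : 'M[R]_n) : posdef A -> psd A.
Proof.
move=> [As Ap]; split=> // v; have [->|v0] := eqVneq v 0; last exact/ltW/Ap.
by rewrite mulmx0 dotv_ge0.
Qed.

Lemma psd_congr n m (A : 'M[R]_n) (T : 'M[R]_(m, n)) :
  psd A -> psd (T *m A *m T^T).
Proof.
move=> [As A0]; split; first by rewrite !trmx_mul trmxK As mulmxA.
by move=> v; rewrite -!mulmxA dotv_trmx.
Qed.

Lemma mxtrace_diag_congr n (O : 'M[R]_n) (d : 'rV[R]_n) :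
  O *m O^T = 1%:M -> \tr (O^T *m diag_mx d *m O) = \sum_i d 0 i.
Proof. by move=> OO; rewrite mxtrace_mulC mulmxA OO mul1mx mxtrace_diag. Qed.

Lemma det_diag_congr n (O : 'M[R]_n) (d : 'rV[R]_n) :
  O *m O^T = 1%:M -> \det (O^T *m diag_mx d *m O) = \prod_i d 0 i.
Proof.
move=> OO; rewrite !det_mulmx mulrAC mulrC -det_mulmx (mulmx1C OO) det1 mulr1.
by rewrite det_diag.
Qed.

Lemma diag_congr_quad n (O : 'M[R]_n) (d : 'rV[R]_n) (v : 'cV[R]_n) :
  dotv (O^T *m diag_mx d *m O *m v) v = \sum_i d 0 i * ((O *m v) i 0) ^+ 2.
Proof.
rewrite -!mulmxA dotv_trmx trmxK; apply: eq_bigr => i _.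
by rewrite mul_diag_mx mxE expr2 mulrA.
Qed.

Lemma diag_congr_eigen n (O : 'M[R]_n) (d : 'rV[R]_n) (k : 'I_n)
    (v := O^T *m delta_mx k (0 : 'I_1)) :
  O *m O^T = 1%:M -> dotv (O^T *m diag_mx d *m O *m v) v = d 0 k.
Proof.
move=> OO; rewrite diag_congr_quad mulmxA OO mul1mx (bigD1 k)//= mxE !eqxx.
rewrite expr1n mulr1 big1 ?addr0// => i ik.
by rewrite mxE (negbTE ik) expr0n mulr0.
Qed.

Lemma diag_congr_mul n (O : 'M[R]_n) (d e : 'rV[R]_n) :
  O *m O^T = 1%:M ->
  (O^T *m diag_mx d *m O) *m (O^T *m diag_mx e *m O) =
  O^T *m diag_mx (\row_i (d 0 i * e 0 i)) *m O.
Proof.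
by move=> OO; rewrite !mulmxA -(mulmxA _ O) OO mulmx1 -(mulmxA O^T) mulmx_diag.
Qed.

Lemma psd_spectral n (A : 'M[R]_n) : psd A ->
  exists (O : 'M[R]_n) (d : 'rV[R]_n),
    [/\ O *m O^T = 1%:M, A = O^T *m diag_mx d *m O & forall i, 0 <= d 0 i].
Proof.
move=> [As A0]; have [ O [d [OO AE]]] := spectral_theorem As.
exists O, d; split => // k.
by rewrite -(diag_congr_eigen d k OO) -AE.
Qed.

Lemma posdef_spectral n (A : 'M[R]_n) : posdef A ->
  exists (O : 'M[R]_n) (d : 'rV[R]_n),
    [/\ O *m O^T = 1%:M, A = O^T *m diag_mx d *m O & forall i, 0 < d 0 i].
Proof.
move=> [As A0]; have [ O [d [OO AE]]] := spectral_theorem As.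
exists O, d; split => // k; rewrite -(diag_congr_eigen d k OO) -AE; apply: A0.
apply/eqP => /(congr1 (mulmx O)); rewrite mulmxA OO mul1mx mulmx0.
by move=> /matrixP/(_ k 0)/eqP; rewrite !mxE !eqxx oner_eq0.
Qed.

Lemma posdef_det_gt0 n (A : 'M[R]_n) : posdef A -> 0 < \det A.
Proof.
move=> /posdef_spectral[ O [d [OO -> d0]]]; rewrite det_diag_congr//.
exact: prodr_gt0.
Qed.

Lemma psd_posdef n (A : 'M[R]_n) : psd A -> \det A != 0 -> posdef A.
Proof.
move=> Apsd dA; split; first by case: Apsd.
have [ O [d [OO AE d0]]] := psd_spectral Apsd.
rewrite AE det_diag_congr// in dA *; move=> v v0.
have dn0 i : d 0 i != 0 by move/prodf_neq0: dA => /(_ i isT).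
have {}d0 i : 0 < d 0 i by rewrite lt_def d0 dn0.
have Ov : O *m v != 0.
  apply: contraNneq v0 => /(congr1 (mulmx O^T)).
  by rewrite mulmxA (mulmx1C OO) mul1mx mulmx0 => ->.
rewrite diag_congr_quad lt_def sumr_ge0 ?andbT; last first.
  by move=> i _; rewrite mulr_ge0 ?sqr_ge0 ?ltW.
apply: contraNneq Ov => /eqP.
rewrite psumr_eq0 => [/allP Z|i _]; last by rewrite mulr_ge0 ?sqr_ge0 ?ltW.
apply/eqP/colP => i; have /(_ (mem_index_enum i)) := Z i.
by rewrite mulf_eq0 gt_eqF//= sqrf_eq0 => /eqP ->; rewrite mxE.
Qed.

Lemma posdef_unit n (A : 'M[R]_n) : posdef A -> A \in unitmx.
Proof. by move=> /posdef_det_gt0 d0; rewrite unitmxE unitfE gt_eqF. Qed.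

Lemma posdef_inv n (A : 'M[R]_n) : posdef A -> posdef (invmx A).
Proof.
move=> Ap; have Au := posdef_unit Ap; have [As A0] := Ap.
have Ais : (invmx A)^T = invmx A by rewrite trmx_inv As.
split=> // v v0; have := A0 (invmx A *m v).
rewrite mulKVmx// dotvC; apply.
by apply: contraNneq v0 => /(congr1 (mulmx A)); rewrite mulKVmx// mulmx0 => ->.
Qed.

(** Writing P = T^T T, the trace and the determinant of X P are those of the
    positive semidefinite matrix T X T^T, whose eigenvalues have arithmetic mean
    at most 1. *)
Lemma psd_det_mul_le n (X P : 'M[R]_n) : psd X -> psd P ->
  \tr (X *m P) <= n%:R -> \det X * \det P <= 1.
Proof.
move=> Xp /psd_spectral[ O [d [OO PE d0]]].
pose T := diag_mx (\row_i Num.sqrt (d 0 i)) *m O.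
have {PE} PE : P = T^T *m T.
  rewrite PE /T trmx_mul tr_diag_mx -!mulmxA; congr (_ *m _).
  rewrite mulmxA mulmx_diag; congr (diag_mx _ *m _).
  by apply/rowP => i; rewrite !mxE -expr2 sqr_sqrtr.
rewrite PE mulmxA mxtrace_mulC mulmxA -det_mulmx mulmxA.
rewrite det_mulmx mulrC -det_mulmx mulmxA.
have /psd_spectral[U [e [UU -> e0]]] := psd_congr T Xp.
rewrite mxtrace_diag_congr// det_diag_congr// => tr.
case: n => [|n] in e e0 tr {Xp X P O d OO d0 T PE U UU} *.
  by rewrite big_ord0.
have /= [+ _] := @leif_AGM R 'I_n.+1 [pred i | true] (fun i => e 0 i) (fun i _ => e0 i).
rewrite cardT -cardE card_ord => /le_trans; apply.
apply: exprn_ile1; first by rewrite divr_ge0 ?sumr_ge0.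
by rewrite ler_pdivrMr ?ltr0n// mul1r.
Qed.

Lemma trace_pairs n (X : 'M[R]_n) (g : R) : psd X -> 0 <= g ->
  g ^+ n = \det X ->
  n%:R * (n%:R - 1) * g ^+ 2 <= (\tr X) ^+ 2 - \tr (X *m X).
Proof.
move=> /psd_spectral[ O [d [OO -> d0]]] g0.
rewrite diag_congr_mul// !mxtrace_diag_congr// det_diag_congr// => gd.
have := geo_mean_sq_le_pairs d0 g0 gd.
by under [in X in _ -> _ <= _ - X]eq_bigr do rewrite mxE -expr2.
Qed.

(** Here S is the inverse square root of P. Let m_k^2 be the eigenvalues of P and
    w_k the coordinates of v in an eigenbasis. The hypothesis on v says that the
    numbers w_k^2 / m_k^2 sum to 1, and v - S v has squared length
    sum_k (w_k^2 / m_k^2) (m_k - 1)^2, so [AMGM_gap1] applies to each term. *)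
Lemma inverse_sqrt n (P : 'M[R]_n) (g : R) : posdef P -> 0 <= g ->
  g ^+ n = \det P -> \tr P = n%:R ->
  exists S : 'M[R]_n, [/\ S^T = S, S *m P *m S = 1%:M &
    forall v, dotv (invmx P *m v) v = 1 ->
      dotv (v - S *m v) (v - S *m v) <= n%:R * (1 - g)].
Proof.
move=> Pp g0; have [ O [d [OO PE d0]]] := posdef_spectral Pp.
have OtO := mulmx1C OO.
pose m i := Num.sqrt (d 0 i).
have m2 i : m i ^+ 2 = d 0 i by rewrite sqr_sqrtr ?ltW.
have m0 i : 0 < m i by rewrite sqrtr_gt0.
have diag1 (e : 'rV[R]_n) : (forall i, e 0 i = 1) ->
    O^T *m diag_mx e *m O = 1%:M.
  move=> e1; rewrite (_ : e = const_mx 1) ?diag_const_mx ?mulmx1//.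
  by apply/rowP => i; rewrite e1 mxE.
pose S := O^T *m diag_mx (\row_i (m i)^-1) *m O.
have iP : invmx P = O^T *m diag_mx (\row_i (d 0 i)^-1) *m O.
  rewrite -[RHS]mulmx1 -(mulmxV (posdef_unit Pp)) mulmxA.
  rewrite [X in _ *m X *m _]PE diag_congr_mul// diag1 ?mul1mx// => i.
  by rewrite !mxE mulVf ?gt_eqF.
rewrite PE mxtrace_diag_congr// det_diag_congr// => gd trd; rewrite -PE.
exists S; split.
- by rewrite /S !trmx_mul trmxK tr_diag_mx mulmxA.
- rewrite /S PE !diag_congr_mul// diag1// => i.
  by rewrite !mxE -m2; have := m0 i; move=> mi; field; rewrite gt_eqF.
move=> v; rewrite iP diag_congr_quad.
have SE : 1%:M - S = O^T *m diag_mx (\row_i (1 - (m i)^-1)) *m O.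
  rewrite -(diag1 (const_mx 1)) => [|i]; last by rewrite mxE.
  rewrite /S -mulmxBl -mulmxBr -linearB/=; congr (_ *m diag_mx _ *m _).
  by apply/rowP => i; rewrite !mxE.
have -> : v - S *m v = (1%:M - S) *m v by rewrite mulmxBl mul1mx.
rewrite {}SE -!mulmxA dotv_trmx trmxK (mulmxA O) OO mul1mx.
set w := O *m v => vX.
apply: (@le_trans _ _ (\sum_i n%:R * (1 - g) * ((d 0 i)^-1 * w i 0 ^+ 2))).
  apply: ler_sum => i _; rewrite mul_diag_mx !mxE -expr2.
  have := AMGM_gap1 i (fun i => ltW (m0 i)) g0.
  rewrite gd (eq_bigr _ (fun i _ => m2 i)) => /(_ erefl).
  rewrite -trd (eq_bigr _ (fun i _ => m2 i)) => /(_ erefl) gap.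
  rewrite mulrA exprMn ler_wpM2r ?sqr_ge0// ler_pdivlMr// -m2 -exprMn.
  by rewrite mulrBl mul1r mulVf// gt_eqF.
rewrite -mulr_sumr [X in _ * X](_ : _ = 1) ?mulr1// -vX.
by apply: eq_bigr => i _; congr (_ * _); rewrite mxE.
Qed.
End Psd.

(** * Volumes of ellipsoids *)

Section Schur.
Variable R : realType.

Lemma dotv_col_mx m n (a c : 'cV[R]_m) (b d : 'cV[R]_n) :
  dotv (col_mx a b) (col_mx c d) = dotv a c + dotv b d.
Proof. by rewrite !dotvE tr_col_mx mul_row_col mxE. Qed.

(** Completing the square in the last n coordinates: u is Y^-1 b for the
    off-diagonal block b, and s = X_00 - <b, u> is the Schur complement of Y. *)
Lemma schur_complement n (X : 'M[R]_(1 + n)) : posdef X ->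
  exists (Y : 'M[R]_n) (s : R) (u : 'cV[R]_n),
    [/\ posdef Y, 0 < s, \det X = s * \det Y &
      forall t z, dotv (X *m col_mx (t%:M : 'cV_1) z) (col_mx (t%:M : 'cV_1) z) =
        s * t ^+ 2 + dotv (Y *m (z + t *: u)) (z + t *: u)].
Proof.
move=> [Xsym X0]; pose Y := drsubmx X; pose b := dlsubmx X.
pose a := ulsubmx X 0 0.
have XE : X = block_mx a%:M b^T b Y.
  by rewrite -[LHS]submxK trmx_dlsub Xsym -mx11_scalar.
have Ysym : Y^T = Y by rewrite trmx_drsub Xsym.
have quadE t z : dotv (X *m col_mx (t%:M : 'cV_1) z) (col_mx (t%:M : 'cV_1) z) =
    a * t ^+ 2 + 2 * t * dotv b z + dotv (Y *m z) z.
  rewrite XE mul_block_col dotv_col_mx !dotvDl !mul_mx_scalar !dotvZl.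
  have -> : dotv (a%:M) (t%:M : 'cV_1) = a * t.
    by rewrite /dotv big_ord1 !mxE !eqxx !mulr1n.
  have -> : dotv (b^T *m z) (t%:M : 'cV_1) = t * dotv b z.
    by rewrite /dotv big_ord1 -/(dotv b z) dotvE [_%:M _ _]mxE eqxx mulr1n mulrC.
  by ring.
have Yp : posdef Y.
  split=> // v v0; have := X0 (col_mx (0%:M : 'cV_1) v); rewrite quadE.
  rewrite expr0n !mulr0 mul0r !add0r; apply.
  by apply: contraNneq v0 => /eqP; rewrite col_mx_eq0 => /andP[_ /eqP ->].
pose u := invmx Y *m b; pose s := a - dotv b u.
have Yu : Y *m u = b by rewrite /u mulKVmx// posdef_unit.
have quadE2 t z : dotv (X *m col_mx (t%:M : 'cV_1) z) (col_mx (t%:M : 'cV_1) z) =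
    s * t ^+ 2 + dotv (Y *m (z + t *: u)) (z + t *: u).
  rewrite quadE mulmxDr -scalemxAr Yu !dotvDl !dotvDr !dotvZl !dotvZr.
  by rewrite (dotv_trmx Y z u) Ysym Yu (dotvC z b) /s; ring.
exists Y, s, u; split=> //.
- have := X0 (col_mx (1%:M : 'cV_1) (- u)).
  rewrite quadE2 scale1r addNr dotv0r addr0 expr1n mulr1; apply.
  apply/eqP => /(congr1 usubmx); rewrite col_mxKu => /matrixP/(_ 0 0)/eqP.
  by rewrite !mxE eqxx oner_eq0.
- have T : X *m block_mx (1%:M : 'M[R]_1) 0 (- u) 1%:M = block_mx s%:M b^T 0 Y.
    rewrite XE mulmx_block !mulmx1 !mulmx0 !add0r !mulmxN Yu subrr.
    congr block_mx; rewrite /s rmorphB/=; congr (_ - _).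
    by rewrite dotvE -mx11_scalar.
  have := congr1 determinant T.
  by rewrite det_mulmx det_lblock det_ublock !det1 !mulr1 det_scalar1.
Qed.
End Schur.

Section Volume.
Variable R : realType.
Notation mu := (@lebesgue_measure R).

(** The slice of the unit ball of dimension m + 1 at height t is a ball of
    dimension m and radius sqrt (1 - t^2); this is the factor between the volumes
    of the two unit balls. *)
Definition slice_integral (m : nat) : R :=
  fine (\int[mu]_(t in `[(-1 : R)%R, 1%R]) ((Num.sqrt (1 - t ^+ 2)) ^+ m)%:E)%E.

Fixpoint unit_ball_volume (n : nat) : R :=
  if n is m.+1 then unit_ball_volume m * slice_integral m else 1.

Lemma slice_continuous (r s c : R) m :
  continuous (fun t : R => (Num.sqrt (r - s * (t - c) ^+ 2)) ^+ m).
Proof.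
move=> t.
apply: (@continuous_comp _ _ _ (fun t : R => Num.sqrt (r - s * (t - c) ^+ 2))
  (fun x : R => x ^+ m)); last exact: exprn_continuous.
apply: (@continuous_comp _ _ _ (fun t : R => r - s * (t - c) ^+ 2)
  (@Num.sqrt R)); last exact: sqrt_continuous.
apply: (@continuousB _ _ _ (fun=> r)); first exact: cst_continuous.
apply: (@continuousM _ _ (fun=> s)); first exact: cst_continuous.
apply: (@continuous_comp _ _ _ (fun t : R => t - c) (fun x : R => x ^+ 2)).
  by apply: continuousB; [exact: cvg_id|exact: cst_continuous].
exact: exprn_continuous.
Qed.

Lemma unit_slice_continuous m :
  continuous (fun t : R => (Num.sqrt (1 - t ^+ 2)) ^+ m).
Proof.
move=> t; have := @slice_continuous 1 1 0 m t.
by under eq_fun do rewrite mul1r subr0.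
Qed.

Lemma slice_integralE (m : nat) :
  (\int[mu]_(t in `[(-1 : R)%R, 1%R]) ((Num.sqrt (1 - t ^+ 2)) ^+ m)%:E)%E =
  (slice_integral m)%:E.
Proof.
rewrite fineK//; apply: integrable_fin_num => //.
apply: continuous_compact_integrable; first exact: segment_compact.
exact/continuous_subspaceT/unit_slice_continuous.
Qed.

Lemma slice_integral_gt0 m : 0 < slice_integral m.
Proof.
rewrite -lte_fin -slice_integralE.
(* The integrand is at least (1/2)^m on [0, 1/2]. *)
apply: (@lt_le_trans _ _ (\int[mu]_(t in `[(0:R)%R, (1/2)%R]) ((1/2) ^+ m)%:E)%E).
  rewrite integral_cst//= lebesgue_measure_itv/= lte_fin ifT ?divr_gt0//.
  by rewrite sube0 -EFinM lte_fin mulr_gt0 ?exprn_gt0 ?divr_gt0.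
have mf : measurable_fun (`[(-1 : R)%R, 1%R] : set R)
    (fun t : R => (Num.sqrt (1 - t ^+ 2)) ^+ m : R).
  apply: measurable_funTS; apply: continuous_measurable_fun.
  exact: unit_slice_continuous.
have sub : `[(0:R)%R, (1/2)%R] `<=` `[(-1 : R)%R, 1%R].
  by move=> t /=; rewrite !in_itv/= => /andP[? ?]; apply/andP; split; lra.
apply: (@le_trans _ _ (\int[mu]_(t in `[(0:R)%R, (1/2)%R])
    ((Num.sqrt (1 - t ^+ 2)) ^+ m)%:E)%E).
  apply: ge0_le_integral => //=.
  - apply/measurable_EFinP; exact: (measurable_funS _ sub).
  - move=> t; rewrite in_itv/= => /andP[t0 t1].
    rewrite lee_fin lerXn2r ?nnegrE ?sqrtr_ge0 ?divr_ge0//.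
    by rewrite -[leLHS]ger0_norm// -sqrtr_sqr ler_wsqrtr//; nra.
by apply: ge0_subset_integral => //=; exact/measurable_EFinP.
Qed.

Lemma unit_ball_volume_gt0 n : 0 < unit_ball_volume n.
Proof.
by elim: n => [|n IH]; rewrite /= ?ltr01// mulr_gt0// slice_integral_gt0.
Qed.

(** The integrand lives on the interval of radius rho = sqrt (r / s) around c, onto
    which t |-> rho t + c maps [-1, 1]. *)
Lemma integral_slices (r s c k : R) m : 0 <= r -> 0 < s -> 0 <= k ->
  (\int[mu]_x (if 0 <= r - s * (x - c) ^+ 2
               then k * Num.sqrt (r - s * (x - c) ^+ 2) ^+ m else 0)%:E)%E =
  (k * slice_integral m * Num.sqrt r ^+ m.+1 / Num.sqrt s)%:E.
Proof.
move=> r0 s0 k0; pose rho := Num.sqrt r / Num.sqrt s.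
have ss0 : Num.sqrt s != 0 by rewrite gt_eqF// sqrtr_gt0.
have rho0 : 0 <= rho by rewrite divr_ge0 ?sqrtr_ge0.
have rhoE : s * rho ^+ 2 = r.
  by rewrite /rho expr_div_n (sqr_sqrtr r0) (sqr_sqrtr (ltW s0)) mulrC divfK// gt_eqF.
pose G x := k * Num.sqrt (r - s * (x - c) ^+ 2) ^+ m.
have GE : (\int[mu]_x (if 0 <= r - s * (x - c) ^+ 2
    then k * Num.sqrt (r - s * (x - c) ^+ 2) ^+ m else 0)%:E)%E =
    (\int[mu]_(x in `[(rho * -1 + c)%R, (rho * 1 + c)%R]) (G x)%:E)%E.
  rewrite [RHS]integral_mkcond; apply: eq_integral => x _.
  rewrite patchE mem_setE in_itv/=.
  rewrite (_ : (_ <= _ <= _) = (0 <= r - s * (x - c) ^+ 2)); first by case: ifP.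
  rewrite -rhoE -mulrBr pmulr_rge0// subr_ge0.
  rewrite -[(x - c) ^+ 2]real_normK ?num_real// ler_sqr ?nnegrE// ler_norml.
  by rewrite mulrN1 mulr1 lerBrDr lerBlDr.
(* For rho = 0 the substitution is not strictly increasing, but the interval is
   a single point. *)
rewrite GE; move: rho0; rewrite le_eqVlt => /predU1P[rho0|rho0].
  rewrite -rho0 !mul0r add0r set_itv1 integral_set1.
  by rewrite -rhoE -rho0 expr0n mulr0 sqrtr0 expr0n/= !mulr0 mul0r.
have Fd (t : R) : is_derive t (1 : R) (fun t : R => rho * t + c : R) rho.
  by apply: is_derive_eq; rewrite addr0 [LHS]mulr1.
have F' : derive1 (fun t : R => rho * t + c : R) = cst rho.
  by apply/funext => t; rewrite derive1E derive_val.
rewrite (@integration_by_substitution_increasing _ (fun t => rho * t + c)).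
- rewrite F'; transitivity (\int[mu]_(t in `[(-1 : R)%R, 1%R])
    ((k * rho * Num.sqrt r ^+ m)%:E * ((Num.sqrt (1 - t ^+ 2)) ^+ m)%:E))%E.
    apply: eq_integral => t _; rewrite -EFinM; congr (_%:E).
    rewrite fctE /G/=.
    have -> : r - s * (rho * t + c - c) ^+ 2 = r * (1 - t ^+ 2).
      by rewrite -rhoE; ring.
    by rewrite sqrtrM// exprMn; ring.
  rewrite ge0_integralZl_EFin//=; first last.
  + by rewrite !mulr_ge0// ?exprn_ge0// ltW.
  + apply/measurable_EFinP; apply: measurable_funTS.
    by apply: continuous_measurable_fun; exact: unit_slice_continuous.
  rewrite slice_integralE -EFinM; congr (_%:E).
  by rewrite /rho exprS; field.
- by [].
- by move=> x y _ _ xy; rewrite ltrD2r ltr_pM2l.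
- by move=> x _; rewrite F'; exact: cst_continuous.
- by rewrite F'; exact: is_cvg_cst.
- by rewrite F'; exact: is_cvg_cst.
- have Fc (t : R) : {for t, continuous (fun t : R => rho * t + c : R)}.
    by apply/differentiable_continuous/derivable1_diffP; case: (Fd t).
  split.
  + by move=> t _; case: (Fd t).
  + exact/cvg_at_right_filter/Fc.
  + exact/cvg_at_left_filter/Fc.
- apply: continuous_subspaceT => x.
  by apply: cvgM; [exact: cst_continuous|exact: slice_continuous].
Qed.

Lemma volumeS n (A : set 'cV[R]_n.+1) :
  volume A = (\int[mu]_x volume
    [set v : 'cV[R]_n | A (col_mx (x%:M : 'cV[R]_1) v)])%E.
Proof. by []. Qed.

(** An arbitrary level r is needed for the induction: slicing the ellipsoid at a
    first coordinate at distance x from that of the center leaves an ellipsoid of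
    level r - s x^2, which is empty once this is negative. In dimension 0 the
    formula at r = 0 relies on 0 ^+ 0 = 1. *)
Lemma volume_ellipsoid n (X : 'M[R]_n) (c : 'cV[R]_n) (r : R) : posdef X ->
  volume [set v | dotv (X *m (v - c)) (v - c) <= r] =
  (if 0 <= r then unit_ball_volume n * Num.sqrt r ^+ n / Num.sqrt (\det X)
   else 0)%:E.
Proof.
elim: n X c r => [|n IH] X c r Xp.
  rewrite /= det_mx00 sqrtr1 divr1 expr0 mulr1 indicE; congr (_%:E).
  rewrite (_ : (_ \in _) = (0 <= r)); first by case: ifP.
  by apply/idP/idP; rewrite inE /= /dotv big_ord0.
have [Y [s [u [Yp s0 detX quad]]]] := schur_complement Xp.
pose c0 := (usubmx (c : 'cV[R]_(1 + n))) 0 0.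
pose c1 := dsubmx (c : 'cV[R]_(1 + n)).
have cE : c = col_mx (c0%:M : 'cV[R]_1) c1.
  by rewrite -[LHS](@vsubmxK _ 1 n) -mx11_scalar.
pose k := unit_ball_volume n / Num.sqrt (\det Y).
have k0 : 0 <= k by rewrite divr_ge0 ?sqrtr_ge0 ?ltW ?unit_ball_volume_gt0.
transitivity (\int[mu]_x (if 0 <= r - s * (x - c0) ^+ 2
               then k * Num.sqrt (r - s * (x - c0) ^+ 2) ^+ n else 0)%:E)%E.
  rewrite volumeS; apply: eq_integral => x _.
  have -> : [set v : 'cV[R]_n | [set v | dotv (X *m (v - c)) (v - c) <= r]
      (col_mx (x%:M : 'cV[R]_1) v)] =
    [set v | dotv (Y *m (v - (c1 - (x - c0) *: u))) (v - (c1 - (x - c0) *: u))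
      <= r - s * (x - c0) ^+ 2].
    apply: eq_set => v /=.
    have -> : col_mx (x%:M : 'cV[R]_1) v - c =
        col_mx ((x - c0)%:M : 'cV[R]_1) (v - c1).
      rewrite cE.
      have := opp_col_mx (c0%:M : 'cV[R]_1) c1 => /(congr1 (+%R (col_mx x%:M v))).
      by rewrite add_col_mx -raddfB.
    by rewrite quad lerBrDl opprB addrA addrAC.
  by rewrite IH//; case: ifP => // _; congr (_%:E); rewrite /k mulrAC.
have sq : Num.sqrt (\det X) = Num.sqrt s * Num.sqrt (\det Y).
  by rewrite detX sqrtrM// ltW.
case: ifPn => [r0|]; last first.
  rewrite -ltNge => r0; apply: integral0_eq => x _.
  rewrite ifF//; apply/negbTE; rewrite -ltNge.
  by rewrite (le_lt_trans _ r0)// gerBl mulr_ge0 ?sqr_ge0// ltW.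
rewrite integral_slices//; congr (_%:E); rewrite sq /k/=.
have sn0 : Num.sqrt s != 0 by rewrite gt_eqF// sqrtr_gt0.
have yn0 : Num.sqrt (\det Y) != 0.
  by rewrite gt_eqF// sqrtr_gt0 posdef_det_gt0.
by field; rewrite ?sn0 ?yn0.
Qed.

Lemma posdef1 n : posdef (1%:M : 'M[R]_n).
Proof.
split=> [|v v0]; first by rewrite trmx1.
by rewrite mul1mx lt_def dotv_eq0 v0 dotv_ge0.
Qed.

Lemma volume_unit_ball n :
  volume (@unit_ball R n) = (unit_ball_volume n)%:E.
Proof.
have -> : @unit_ball R n = [set v | dotv (1%:M *m (v - 0)) (v - 0) <= 1].
  apply: eq_set => v; rewrite mul1mx subr0 -norm2_sqr expr_le1 ?norm2_ge0//.
rewrite (volume_ellipsoid _ _ (posdef1 n)) ler01 det1 sqrtr1 divr1.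
by rewrite expr1n mulr1.
Qed.
End Volume.

(** * Caratheodory's theorem for cones *)

(** There are more vectors, indexed by S, than coordinates, so the matrix having
    these vectors as rows has a nonzero left kernel. *)
Lemma linear_relation (R : fieldType) (I T : finType) (F : I -> T -> R)
    (S : {pred I}) : (#|T| < #|S|)%N ->
  exists b : I -> R, [/\ forall i, i \notin S -> b i = 0,
    exists i, b i != 0 & forall x, \sum_i b i * F i x = 0].
Proof.
move=> TS.
pose A := \matrix_(k < #|S|, j < #|T|) F (enum_val k) (enum_val j).
have /rowV0Pn[w /sub_kermxP wA w0] : kermx A != 0.
  rewrite kermx_eq0; apply: contraTN TS => /eqP rA.
  by rewrite -leqNgt -[leqLHS]rA rank_leq_col.
pose b i := \sum_(k < #|S| | enum_val k == i) w 0 k.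
have bE k : b (enum_val k) = w 0 k.
  rewrite /b (eq_bigl (pred1 k)) ?big_pred1_eq// => j.
  by rewrite (inj_eq enum_val_inj).
exists b; split.
- move=> i iS; rewrite /b big_pred0// => k; apply: contraNF iS => /eqP <-.
  exact: enum_valP.
- have /existsP[k wk] : [exists k, w 0 k != 0].
    apply: contraNT w0 => /existsPn H; apply/eqP/rowP => k.
    by move/negPn/eqP: (H k); rewrite mxE.
  by exists (enum_val k); rewrite bE.
- move=> x; have := congr1 (fun B : 'rV_ _ => B 0 (enum_rank x)) wA.
  rewrite !mxE => wAx; rewrite -[RHS]wAx.
  transitivity (\sum_i \sum_(k < #|S| | enum_val k == i) w 0 k * F i x).
    by apply: eq_bigr => i _; rewrite mulr_suml.
  rewrite (exchange_big_dep xpredT)//=; apply: eq_bigr => k _.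
  rewrite (big_pred1 (enum_val k)) => [|i]; last by rewrite eq_sym.
  by rewrite mxE enum_rankK.
Qed.

(** While the support is too large, subtract a multiple of a linear relation
    supported there: the largest multiple that keeps all coefficients nonnegative
    makes one of them vanish. *)
Lemma conic_caratheodory (R : realFieldType) (I T : finType)
    (F : I -> T -> R) (c : I -> R) : (forall i, 0 <= c i) ->
  exists c' : I -> R, [/\ forall i, 0 <= c' i,
    forall x, \sum_i c' i * F i x = \sum_i c i * F i x &
    (#|[pred i | c' i != 0%R]| <= #|T|)%N].
Proof.
have [m] := ubnP #|[pred i | c i != 0%R]|; elim: m c => // m IH c cm c0.
have [small|large] := leqP #|[pred i | c i != 0%R]| #|T|.
  by exists c.
have [b [bS [i0 bi0] bF]] := linear_relation F large.
wlog bi0_gt0 : b bS bF bi0 / 0 < b i0.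
  move=> W; have [|bneg|b0] := ltrgtP (b i0) 0.
  - move=> bneg; apply: (W (fun i => - b i)).
    + by move=> i iS; rewrite bS ?oppr0.
    + by move=> x; under eq_bigr do rewrite mulNr; rewrite sumrN bF oppr0.
    + by rewrite oppr_eq0.
    + by rewrite oppr_gt0.
  - exact: (W b).
  - by rewrite b0 eqxx in bi0.
have [k bk kmin] := @arg_minP _ _ _ i0 (fun i => 0 < b i) (fun i => c i / b i) bi0_gt0.
pose c' i := c i - c k / b k * b i.
have c'0 i : 0 <= c' i.
  rewrite subr_ge0; have [bi|bi] := ltP 0 (b i).
    by rewrite -ler_pdivlMr// kmin.
  by rewrite (le_trans _ (c0 i))// mulr_ge0_le0// divr_ge0// ltW.
have c'F x : \sum_i c' i * F i x = \sum_i c i * F i x.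
  under eq_bigr do rewrite mulrBl -[c k / b k * _ * _]mulrA.
  by rewrite sumrB -mulr_sumr bF mulr0 subr0.
have [|d [d0 dF dT]] := IH c' _ c'0.
  rewrite -ltnS (leq_trans _ cm)// ltnS; apply: proper_card.
  apply/properP; split.
    apply/fintype.subsetP => i; rewrite !inE; apply: contraNneq => ci.
    have bi : b i = 0 by apply: bS; rewrite inE ci eqxx.
    by rewrite /c' ci bi mulr0 subr0.
  exists k; rewrite !inE; last by rewrite /c' divfK ?subrr ?eqxx// gt_eqF.
  by apply: contraTneq bk => ck; rewrite bS ?ltxx// inE ck eqxx.
by exists d; split=> // x; rewrite dF c'F.
Qed.

(** * Weighted sums of outer products *)

(** Both sides are the determinant of the block matrix with rows (1, -w^T) and
    (u, 1), computed from its two Schur complements. *)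
Lemma det_sylvester (R : comUnitRingType) n (u w : 'cV[R]_n) :
  \det (1%:M + u *m w^T) = 1 + (w^T *m u) 0 0.
Proof.
have E1 : block_mx (1%:M : 'M[R]_1) (- w^T) u 1%:M *m block_mx 1%:M w^T 0 1%:M =
    block_mx 1%:M 0 u (1%:M + u *m w^T).
  by rewrite mulmx_block !(mulmx0, mulmx1, mul1mx, addr0, subrr) addrC.
have E2 : block_mx (1%:M : 'M[R]_1) (- w^T) u 1%:M *m
    block_mx 1%:M 0 (- u) 1%:M = block_mx (1%:M + w^T *m u) (- w^T) 0 1%:M.
  rewrite mulmx_block !(mulmx0, mulmx1, mul1mx, add0r, subrr).
  by rewrite mulNmx mulmxN opprK.
have := congr1 determinant E1; rewrite det_mulmx det_ublock det_lblock.
rewrite !det1 !mul1r mulr1 => <-.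
have := congr1 determinant E2; rewrite det_mulmx det_lblock det_ublock.
by rewrite !det1 !mulr1 => ->; rewrite det_mx11 !mxE.
Qed.

Section Design.
Variables (R : realType) (N M : nat).
Implicit Types (Phi : 'M[R]_(N, M)) (c : 'I_M -> R).

Lemma matrix_det_lemma (A : 'M[R]_N) (v : 'cV[R]_N) (t : R) : A \in unitmx ->
  \det (A + t *: (v *m v^T)) = \det A * (1 + t * dotv (invmx A *m v) v).
Proof.
move=> Au; have -> : A + t *: (v *m v^T) =
    A *m (1%:M + (t *: (invmx A *m v)) *m v^T).
  by rewrite mulmxDr mulmx1 -scalemxAl -scalemxAr !mulmxA mulmxV// mul1mx.
rewrite det_mulmx det_sylvester; congr (_ * (1 + _)).
by rewrite -scalemxAr mxE -dotvE dotvC.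
Qed.

(** The frame operator of the rescaled vectors sqrt (c_i) phi_i. The two matrix
    quantities of the problem are expressed by it: a frame is scalable when some
    frame_op Phi c is the identity, and [dist_identity] is the distance of the
    identity to the cone of all frame_op Phi c. *)
Definition frame_op Phi c : 'M[R]_N :=
  \sum_(i < M) c i *: (col i Phi *m (col i Phi)^T).

Lemma frame_opE Phi c i j : frame_op Phi c i j = \sum_k c k * (Phi i k * Phi j k).
Proof.
by rewrite summxE; apply: eq_bigr => k _; rewrite !mxE big_ord1 !mxE.
Qed.

Lemma frame_op_quad Phi c v :
  dotv (frame_op Phi c *m v) v = \sum_i c i * dotv v (col i Phi) ^+ 2.
Proof.
rewrite dotvC dotvE mulmxA /frame_op mulmx_sumr mulmx_suml summxE.
apply: eq_bigr => i _; rewrite -scalemxAr -scalemxAl mxE; congr (_ * _).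
rewrite [v^T *m _]mulmxA -(mulmxA (v^T *m _)) [v^T *m _]mx11_scalar.
by rewrite mul_scalar_mx mxE -!dotvE [in X in _ * X]dotvC expr2.
Qed.

Lemma frame_op_sym Phi c : (frame_op Phi c)^T = frame_op Phi c.
Proof.
rewrite /frame_op linear_sum/=; apply: eq_bigr => i _.
by rewrite linearZ/= trmx_mul trmxK.
Qed.

Lemma frame_op_psd Phi c : (forall i, 0 <= c i) -> psd (frame_op Phi c).
Proof.
move=> c0; split; first exact: frame_op_sym.
by move=> v; rewrite frame_op_quad sumr_ge0// => i _; rewrite mulr_ge0 ?sqr_ge0.
Qed.

Lemma mxtrace_mul_frame_op Phi c (A : 'M[R]_N) :
  \tr (A *m frame_op Phi c) = \sum_i c i * dotv (A *m col i Phi) (col i Phi).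
Proof.
rewrite /frame_op mulmx_sumr linear_sum/=; apply: eq_bigr => i _.
by rewrite -scalemxAr linearZ/= quad_trace.
Qed.

Lemma mxtrace_frame_op Phi c : unit_norm Phi -> \tr (frame_op Phi c) = \sum_i c i.
Proof.
move=> Pu; rewrite -[frame_op _ _]mul1mx mxtrace_mul_frame_op; apply: eq_bigr => i _.
by rewrite mul1mx -norm2_sqr Pu expr1n mulr1.
Qed.

Lemma frame_opZ Phi a c : frame_op Phi (fun i => a * c i) = a *: frame_op Phi c.
Proof. by rewrite /frame_op scaler_sumr; apply: eq_bigr => i _; rewrite scalerA. Qed.

Lemma frame_op_lin Phi a b c d :
  frame_op Phi (fun i => a * c i + b * d i) = a *: frame_op Phi c + b *: frame_op Phi d.
Proof.
rewrite /frame_op !scaler_sumr -big_split; apply: eq_bigr => i _ /=.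
by rewrite !scalerA scalerDl.
Qed.

Lemma frame_op_delta Phi k :
  frame_op Phi (fun i => (i == k)%:R) = col k Phi *m (col k Phi)^T.
Proof.
rewrite /frame_op (bigD1 k)//= eqxx scale1r big1 ?addr0// => i /negbTE ->.
by rewrite scale0r.
Qed.

Lemma card_ord_le_pairs :
  #|{: {p : 'I_N * 'I_N | (p.1 <= p.2)%N}}| = (N * N.+1)./2.
Proof.
rewrite card_sig -sum1_card.
rewrite -(pair_big_dep xpredT (fun i j : 'I_N => (i <= j)%N) (fun _ _ => 1%N))/=.
rewrite (exchange_big_dep xpredT)//=.
transitivity (\sum_(j < N) j.+1)%N.
  apply: eq_bigr => j _; rewrite sum1_card.
  have -> : #|[pred i : 'I_N | (i <= j)%N]| = #|[pred i : 'I_N | (i < j.+1)%N]| by [].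
  rewrite -sum1_card (big_ord_narrow (ltn_ord j)) sum1_card card_ord//.
rewrite -(big_mkord xpredT succn).
have := bin2_sum N.+1; rewrite big_nat_recl// add0n => E.
by rewrite E bin2 mulnC.
Qed.

(** Symmetric matrices are determined by their entries on and above the diagonal,
    so the outer products span at most N (N + 1) / 2 dimensions. *)
Lemma frame_op_caratheodory Phi c : (forall i, 0 <= c i) ->
  exists c', [/\ forall i, 0 <= c' i, frame_op Phi c' = frame_op Phi c &
    (#|[pred i | c' i != 0%R]| <= minn M (N * N.+1)./2)%N].
Proof.
move=> c0.
pose F (i : 'I_M) (p : {p : 'I_N * 'I_N | (p.1 <= p.2)%N}) :=
  Phi (sval p).1 i * Phi (sval p).2 i.
have [c' [c'0 c'F card]] := conic_caratheodory F c0.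
exists c'; split=> //; last first.
  by rewrite leq_min -card_ord_le_pairs card andbT -[leqRHS]card_ord max_card.
have H (i j : 'I_N) : (i <= j)%N -> frame_op Phi c' i j = frame_op Phi c i j.
  by move=> ij; rewrite !frame_opE; have := c'F (exist _ (i, j) ij).
apply/matrixP => i j; have [/H//|/ltnW/H] := leqP i j.
by rewrite -[in LHS]frame_op_sym mxE => ->; rewrite -[in LHS]frame_op_sym mxE.
Qed.
End Design.

(** * Weights of maximal determinant *)

Section Optimal.
Variables (R : realType) (N M : nat).
Implicit Types (Phi : 'M[R]_(N, M)) (c : 'I_M -> R).

Lemma frame_op_det_continuous Phi :
  continuous (fun c : 'rV[R]_M => \det (frame_op Phi (fun i => c 0 i))).
Proof.
have entry i j : continuous (fun c : 'rV[R]_M => frame_op Phi (fun i => c 0 i) i j).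
  have -> : (fun c : 'rV[R]_M => frame_op Phi (fun i => c 0 i) i j) =
      (fun c : 'rV[R]_M => \sum_k c 0 k * (Phi i k * Phi j k)).
    by apply/funext => c; rewrite frame_opE.
  apply: continuous_big => [|k _]; first exact: add_continuous.
  move=> c; apply: (@cvgM _ _ (nbhs c) _ (fun c : 'rV[R]_M => c 0 k)
    (fun=> Phi i k * Phi j k)); last exact: cvg_cst.
  exact: coord_continuous.
rewrite /determinant.
apply: (@continuous_big _ _ _ _ _ _ _ _ (fun (s : 'S_N) (c : 'rV[R]_M) =>
  (-1) ^+ s * \prod_i frame_op Phi (fun i => c 0 i) i (s i))) => [|s _].
  exact: add_continuous.
move=> c; apply: (@cvgM _ _ (nbhs c) _ (fun=> (-1) ^+ s : R)
  (fun c : 'rV[R]_M => \prod_i frame_op Phi (fun i => c 0 i) i (s i))).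
  exact: cvg_cst.
by apply: cvg_big => [|i _]; [exact: mul_continuous|exact: entry].
Qed.

Definition simplex (T : R) : set 'rV[R]_M :=
  [set c | (forall i, 0 <= c 0 i) /\ \sum_i c 0 i = T].

Lemma simplex_compact (T : R) : compact (simplex T).
Proof.
apply: (@subclosed_compact _ _
   [set c : 'rV[R]_M | forall i, `[0%R, T]%classic (c ord0 i)]).
- have -> : simplex T = (\bigcap_i [set c : 'rV[R]_M | 0 <= c 0 i]) `&`
      [set c | \sum_i c 0 i = T].
    by apply/seteqP; split => c /= [c0 cT]; split => // i; [move=> _|]; exact: c0.
  apply: closedI.
    apply: closed_bigI => i _.
    apply: (@closed_comp _ _ (fun c : 'rV[R]_M => c 0 i) [set x | 0 <= x]).
      by move=> c _; exact: coord_continuous.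
    exact: closed_ge.
  apply: (@closed_comp _ _ (fun c : 'rV[R]_M => \sum_i c 0 i) [set x | x = T]).
    move=> c _; apply: (@continuous_big _ _ _ _ _ _ _ _
      (fun i (c : 'rV[R]_M) => c 0 i)) => [|i _]; first exact: add_continuous.
    exact: coord_continuous.
  exact: closed_eq.
- by apply: (@rV_compact R M (fun=> `[0%R, T]%classic)) => i; exact: segment_compact.
- move=> c [c0 cT] i /=; rewrite in_itv/= c0/= -cT (bigD1 i)//= lerDl.
  by rewrite sumr_ge0.
Qed.

(** A continuous function on a compact simplex attains its maximum. *)
Lemma D_optimal_design Phi : (0 < M)%N -> exists2 c,
  (forall i, 0 <= c i) /\ \sum_i c i = N%:R &
  forall d, (forall i, 0 <= d i) -> \sum_i d i = N%:R ->
    \det (frame_op Phi d) <= \det (frame_op Phi c).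
Proof.
move=> M0; have [|c] := EVT_max_rV _ (@simplex_compact N%:R)
    (continuous_subspaceT (@frame_op_det_continuous Phi)).
  exists (const_mx (N%:R / M%:R)); split => [i|].
    by rewrite mxE divr_ge0.
  under eq_bigr do rewrite mxE.
  by rewrite sumr_const card_ord -[_ *+ M]mulr_natr divfK// pnatr_eq0 -lt0n.
rewrite inE => -[c0 cN] cmax; exists (fun i => c 0 i) => // d d0 dN.
have dE : (fun i => (\row_i d i) 0 i) = d by apply/funext => i; rewrite mxE.
have := cmax (\row_i d i); rewrite dE inE; apply; split=> [i|].
  by rewrite mxE.
by under eq_bigr do rewrite mxE.
Qed.

Lemma bernoulli (t : R) m : 0 <= t <= 1 -> 1 - m%:R * t <= (1 - t) ^+ m.
Proof.
move=> /andP[t0 t1]; elim: m => [|m IH]; first by rewrite mul0r subr0 expr0.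
rewrite exprS; have : 0 <= m%:R :> R by [].
rewrite -natr1; move: (m%:R) IH => x IH x0.
apply: le_trans (ler_wpM2l _ IH); last by rewrite subr_ge0.
by nra.
Qed.

(** On the segment from c to the vertex of the simplex at k, [matrix_det_lemma]
    gives the determinant explicitly, and its derivative at c is a positive
    multiple of q - 1, where q is the left-hand side. So q > 1 would contradict
    the maximality of the determinant at c. *)
Lemma kiefer_wolfowitz Phi c k : (forall i, 0 <= c i) -> \sum_i c i = N%:R ->
  0 < \det (frame_op Phi c) ->
  (forall d, (forall i, 0 <= d i) -> \sum_i d i = N%:R ->
    \det (frame_op Phi d) <= \det (frame_op Phi c)) ->
  dotv (invmx (frame_op Phi c) *m col k Phi) (col k Phi) <= 1.
Proof.
move=> c0 cN P0 cmax; set P := frame_op Phi c in P0 cmax *.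
set q := dotv _ _; rewrite leNgt; apply/negP => q1.
have Pu : P \in unitmx by rewrite unitmxE unitfE gt_eqF.
have N0 : (0 < N)%N.
  rewrite lt0n; apply/eqP => N0; move: q1; rewrite /q /dotv big1 ?ltr10//.
  by move=> [i iN]; exfalso; rewrite N0 in iN.
have n0 : 0 < N%:R :> R by rewrite ltr0n.
(* With t q N = (q - 1) / 2 the gain t N (q - 1) of first order exceeds the loss
   of second order. *)
pose t := (q - 1) / (2 * q * N%:R).
have tE : t * (2 * q * N%:R) = q - 1.
  by rewrite divfK// !mulf_neq0// gt_eqF// (lt_trans ltr01).
have t0 : 0 < t by rewrite divr_gt0 ?subr_gt0// !mulr_gt0// (lt_trans ltr01).
have n1 : 1 <= N%:R :> R by rewrite ler1n.
have t1 : t < 1.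
  rewrite -(ltr_pM2r (_ : 0 < 2 * q * N%:R)) ?tE ?mulr_gt0//; last by lra.
  by nra.
pose d i := (1 - t) * c i + (t * N%:R) * (i == k)%:R.
have := cmax d; rewrite /d frame_op_lin frame_op_delta -/P.
have -> : (1 - t) *: P + t * N%:R *: (col k Phi *m (col k Phi)^T) =
    (1 - t) *: (P + (t * N%:R / (1 - t)) *: (col k Phi *m (col k Phi)^T)).
  by rewrite scalerDr scalerA mulrCA divff ?mulr1// subr_eq0 gt_eqF.
rewrite detZ matrix_det_lemma// -/q => H.
have {H} : (1 - t) ^+ N * (\det P * (1 + t * N%:R / (1 - t) * q)) <= \det P.
  apply: H => [i|].
    apply: addr_ge0; first by rewrite mulr_ge0// subr_ge0 ltW.
    by apply: mulr_ge0; [apply: mulr_ge0; [exact: ltW|exact: ler0n]|exact: ler0n].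
  rewrite big_split/= -!mulr_sumr cN (bigD1 k)//= eqxx big1 ?addr0 ?mulr1.
    by ring.
  by move=> i /negbTE ->.
rewrite mulrCA -[leRHS]mulr1 ler_pM2l//; apply/negP; rewrite -ltNge.
have -> : (1 - t) ^+ N * (1 + t * N%:R / (1 - t) * q) =
    (1 - t) ^+ N.-1 * (1 - t + t * N%:R * q).
  have -> : (1 - t) ^+ N = (1 - t) ^+ N.-1 * (1 - t) by rewrite -exprSr prednK.
  rewrite -mulrA; congr (_ * _).
  by field; rewrite subr_eq0 gt_eqF.
have mE : N.-1%:R = N%:R - 1 :> R by rewrite -[in RHS](prednK N0) -natr1 addrK.
have := @bernoulli t N.-1; rewrite (ltW t0) (ltW t1) mE => /(_ isT) B.
move: (N%:R : R) B n0 n1 tE {mE} => x B n0 n1 tE.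
apply: (@lt_le_trans _ _ ((1 - (x - 1) * t) * (1 - t + t * x * q))); last first.
  rewrite ler_wpM2r//; have : 0 < t * x * q.
    by apply: mulr_gt0; [exact: mulr_gt0|exact: lt_trans ltr01 q1].
  by lra.
have : t * (x - 1) * (x * q - 1) < x * (q - 1) by nra.
by move=> H; have := mulr_gt0 t0 (_ : 0 < x * (q - 1) - t * (x - 1) * (x * q - 1));
  rewrite subr_gt0 => /(_ H); nra.
Qed.
End Optimal.

(** * The minimal ellipsoid *)

Section MinimalEllipsoid.
Variables (R : realType) (N M : nat).
Implicit Types (Phi : 'M[R]_(N, M)) (c : 'I_M -> R).

Lemma quad_convex n (X : 'M[R]_n) : psd X ->
  @convex_set R 'cV[R]_n [set v | dotv (X *m (v - 0)) (v - 0) <= 1].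
Proof.
move=> [Xs X0] x y l; rewrite !inE/= !subr0 => qx qy.
have -> : (conv l x y : 'cV[R]_n) =
    l%:num *: (x : 'cV[R]_n) + (1 - l%:num) *: (y : 'cV[R]_n).
  by [].
have a0 : 0 <= l%:num by [].
have a1 : l%:num <= 1 by [].
move: (l%:num) a0 a1 => a a0 a1.
rewrite mulmxDr -!scalemxAr !dotvDl !dotvDr !dotvZl !dotvZr.
have := X0 ((x : 'cV[R]_n) - y); rewrite mulmxBr !dotvDl !dotvDr !dotvNl !dotvNr.
have -> : dotv (X *m y) x = dotv (X *m x) y by rewrite dotvC dotv_trmx Xs.
move: (dotv (X *m x) x) (dotv (X *m x) y) (dotv (X *m y) y) qx qy.
move=> p r q qx qy pqr.
have H : 0 <= a * (1 - a) * (p - r + (- r + q)).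
  by apply: mulr_ge0; [rewrite mulr_ge0// subr_ge0|lra].
have H1 : a * p <= a * 1 by rewrite ler_wpM2l.
have H2 : (1 - a) * q <= (1 - a) * 1 by rewrite ler_wpM2l// subr_ge0.
by lra.
Qed.

(** The lower frame bound makes the frame operator of uniform weights positive
    definite, so the maximal determinant is positive. *)
Lemma optimal_design Phi : (0 < N)%N -> is_frame Phi -> unit_norm Phi ->
  exists c, [/\ forall i, 0 <= c i, \sum_i c i = N%:R, posdef (frame_op Phi c) &
    forall i, dotv (invmx (frame_op Phi c) *m col i Phi) (col i Phi) <= 1].
Proof.
move=> N0 [a [b [a0 ab fb]]] Pu.
have frame_pos : posdef (frame_op Phi (fun=> 1)).
  split; first exact: frame_op_sym.
  move=> v v0; rewrite frame_op_quad; have [+ _] := fb v.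
  under eq_bigr do rewrite real_normK ?num_real//.
  under [in X in _ -> _ < X]eq_bigr do rewrite mul1r.
  apply: lt_le_trans; rewrite norm2_sqr mulr_gt0// lt_def dotv_eq0 v0.
  exact: dotv_ge0.
have M0 : (0 < M)%N.
  rewrite lt0n; apply/eqP => M0; have := posdef_det_gt0 frame_pos.
  rewrite /frame_op big1 => [|[i iM]]; last by exfalso; rewrite M0 in iM.
  by rewrite -[X in \det X](scale0r 0) detZ expr0n eqn0Ngt N0 mul0r ltxx.
have [c [c0 cN] cmax] := D_optimal_design Phi M0.
have detc : 0 < \det (frame_op Phi c).
  apply: (@lt_le_trans _ _ (\det (frame_op Phi (fun=> N%:R / M%:R)))); last first.
    apply: cmax => [i|]; first by rewrite divr_ge0.
    by rewrite sumr_const card_ord -[_ *+ M]mulr_natr divfK// pnatr_eq0 -lt0n.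
  have -> : frame_op Phi (fun=> N%:R / M%:R) = (N%:R / M%:R) *: frame_op Phi (fun=> 1).
    by rewrite /frame_op scaler_sumr; apply: eq_bigr => i _; rewrite scale1r.
  by rewrite detZ mulr_gt0 ?posdef_det_gt0// exprn_gt0// divr_gt0 ?ltr0n.
exists c; split=> //; last by move=> k; exact: kiefer_wolfowitz.
by apply: psd_posdef; [exact: frame_op_psd|rewrite gt_eqF].
Qed.

(** Let X' and c' describe another ellipsoid around the vectors. The mean of the
    two inequalities for phi_i and -phi_i gives <X' phi_i, phi_i> <= 1, as if the
    center were 0. Summing with the weights c bounds tr (X' P) by N, hence
    det X' det P by 1, and volumes are inversely proportional to sqrt (det X'). *)
Lemma minimal_ellipsoidP Phi c :
  (forall i, 0 <= c i) -> \sum_i c i = N%:R -> posdef (frame_op Phi c) ->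
  (forall i, dotv (invmx (frame_op Phi c) *m col i Phi) (col i Phi) <= 1) ->
  is_minimal_ellipsoid Phi
    [set v | dotv (invmx (frame_op Phi c) *m (v - 0)) (v - 0) <= 1].
Proof.
move=> c0 cN Pp q1; have Xp := posdef_inv Pp; split.
- by exists (invmx (frame_op Phi c)), 0.
- apply: smallest_sub; first exact/quad_convex/posdef_psd.
  move=> v [[i _ <-]|[i _ <-]] /=; rewrite subr0//.
  by rewrite mulmxN dotvNl dotvNr opprK.
move=> _ [X' [c' [X'p ->]]] hull.
have pm : pm_columns Phi `<=` [set v | dotv (X' *m (v - c')) (v - c') <= 1].
  apply: subset_trans hull; exact: sub_gen_smallest.
have q' i : dotv (X' *m col i Phi) (col i Phi) <= 1.
  have /= := pm (col i Phi) (or_introl (ex_intro2 _ _ i I erefl)).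
  have /= := pm (- col i Phi) (or_intror (ex_intro2 _ _ i I erefl)).
  rewrite !mulmxBr !dotvDl !dotvDr mulmxN !dotvNl !dotvNr.
  have := (posdef_psd X'p).2 c'; lra.
have := @psd_det_mul_le _ _ X' (frame_op Phi c) (posdef_psd X'p) (posdef_psd Pp).
rewrite mxtrace_mul_frame_op => H.
have {}H : \det X' * \det (frame_op Phi c) <= 1.
  apply: H; rewrite -cN; apply: ler_sum => i _.
  by rewrite -[leRHS]mulr1 ler_wpM2l.
rewrite !volume_ellipsoid// ler01 lee_fin sqrtr1 expr1n mulr1.
have P0 := posdef_det_gt0 Pp; have X'0 := posdef_det_gt0 X'p.
rewrite ler_wpM2l ?(ltW (unit_ball_volume_gt0 _ _))//.
rewrite lef_pV2 ?posrE ?sqrtr_gt0 ?posdef_det_gt0//.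
by rewrite ler_wsqrtr// det_inv -[leRHS]mul1r ler_pdivlMr.
Qed.

(** All minimal ellipsoids have the same volume, which is therefore that of the
    explicit one. *)
Lemma ellipsoid_ratioE Phi c :
  (forall i, 0 <= c i) -> \sum_i c i = N%:R -> posdef (frame_op Phi c) ->
  (forall i, dotv (invmx (frame_op Phi c) *m col i Phi) (col i Phi) <= 1) ->
  ellipsoid_ratio Phi = Num.sqrt (\det (frame_op Phi c)).
Proof.
move=> c0 cN Pp q1; have minE := minimal_ellipsoidP c0 cN Pp q1.
have minG : is_minimal_ellipsoid Phi (minimal_ellipsoid Phi).
  apply: xgetPex.
  by exists [set v | dotv (invmx (frame_op Phi c) *m (v - 0)) (v - 0) <= 1].
have volE : volume (minimal_ellipsoid Phi) =
    volume [set v | dotv (invmx (frame_op Phi c) *m (v - 0)) (v - 0) <= 1].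
  case: minE minG => [E1 E2 E3] [G1 G2 G3].
  by apply/eqP; rewrite eq_le G3// E3.
rewrite /ellipsoid_ratio volE volume_unit_ball.
rewrite (volume_ellipsoid _ _ (posdef_inv Pp)) ler01 /= sqrtr1 expr1n mulr1.
rewrite det_inv sqrtrV ?invrK ?ltW ?posdef_det_gt0//.
by rewrite mulrAC divff ?mul1r// gt_eqF// unit_ball_volume_gt0.
Qed.

Lemma ellipsoid_ratio_geo_mean (P : 'M[R]_N) (V : R) : (0 < N)%N -> 0 < \det P ->
  V = Num.sqrt (\det P) ->
  [/\ 0 < V `^ (2 / N%:R), V `^ (2 / N%:R) ^+ N = \det P &
      V `^ (4 / N%:R) = V `^ (2 / N%:R) ^+ 2].
Proof.
move=> N0 P0 VE; have V0 : 0 < V by rewrite VE sqrtr_gt0.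
have n0 : N%:R != 0 :> R by rewrite pnatr_eq0 -lt0n.
split; first exact: powR_gt0.
  rewrite -powR_mulrn ?powR_ge0// -powRrM divfK// powR_mulrn ?ltW// VE.
  by rewrite sqr_sqrtr// ltW.
rewrite -powR_mulrn ?powR_ge0// -powRrM; congr (_ `^ _).
by field.
Qed.
End MinimalEllipsoid.

(** * Frobenius norm and scalable frames *)

Section Frobenius.
Variable R : realType.

Lemma norm2_triangle n (x y : 'cV[R]_n) : norm2 (x + y) <= norm2 x + norm2 y.
Proof.
rewrite -ler_sqr ?nnegrE ?addr_ge0 ?norm2_ge0//.
rewrite sqrrD !norm2_sqr dotvDl !dotvDr (dotvC y x).
suff : dotv x y <= norm2 x * norm2 y by lra.
apply: le_trans (ler_norm _) _; rewrite -ler_sqr ?nnegrE ?mulr_ge0 ?norm2_ge0//.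
by rewrite real_normK ?num_real// exprMn !norm2_sqr cauchy_schwarz.
Qed.

Lemma norm2Z n a (x : 'cV[R]_n) : norm2 (a *: x) = `|a| * norm2 x.
Proof.
by rewrite /norm2 dotvZl dotvZr mulrA -expr2 sqrtrM ?sqr_ge0// sqrtr_sqr.
Qed.

Lemma dotv_mxvec m n (A B : 'M[R]_(m, n)) :
  dotv (mxvec A)^T (mxvec B)^T = \sum_i \sum_j A i j * B i j.
Proof.
rewrite pair_big /dotv (reindex _ (curry_mxvec_bij m n))/=.
by apply: eq_bigr => -[i j] _; rewrite !mxE !mxvecE.
Qed.

Lemma normF_mxvec m n (A : 'M[R]_(m, n)) : normF A = norm2 (mxvec A)^T.
Proof.
by rewrite /norm2 dotv_mxvec.
Qed.

Lemma normF_ge0 m n (A : 'M[R]_(m, n)) : 0 <= normF A.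
Proof. exact: sqrtr_ge0. Qed.

Lemma normF_triangle m n (A B : 'M[R]_(m, n)) : normF (A + B) <= normF A + normF B.
Proof. by rewrite !normF_mxvec !linearD norm2_triangle. Qed.

Lemma normFZ m n a (A : 'M[R]_(m, n)) : normF (a *: A) = `|a| * normF A.
Proof. by rewrite !normF_mxvec !linearZ/= norm2Z. Qed.

Lemma normF_sum m n (I : finType) (F : I -> 'M[R]_(m, n)) :
  normF (\sum_i F i) <= \sum_i normF (F i).
Proof.
elim/big_rec2: _ => [|i x y _ le].
  by rewrite -(scale0r 0) normFZ normr0 mul0r.
by apply: le_trans (normF_triangle _ _) _; rewrite lerD2l.
Qed.

Lemma normF_sqr_cols m n (A : 'M[R]_(m, n)) :
  normF A ^+ 2 = \sum_j norm2 (col j A) ^+ 2.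
Proof.
rewrite normF_mxvec norm2_sqr dotv_mxvec exchange_big; apply: eq_bigr => j _.
by rewrite norm2_sqr; apply: eq_bigr => i _; rewrite !mxE.
Qed.

Lemma normF_outer m n (u : 'cV[R]_m) (w : 'cV[R]_n) :
  normF (u *m w^T) = norm2 u * norm2 w.
Proof.
rewrite /norm2 -sqrtrM ?dotv_ge0//; congr Num.sqrt.
rewrite /dotv big_distrl; apply: eq_bigr => i _; rewrite big_distrr.
by apply: eq_bigr => j _; rewrite !mxE big_ord1 !mxE/=; ring.
Qed.

Lemma normF_sqr_sym n (A : 'M[R]_n) : A^T = A -> normF A ^+ 2 = \tr (A *m A).
Proof.
move=> As; rewrite normF_mxvec norm2_sqr dotv_mxvec; apply: eq_bigr => i _.
by rewrite mxE; apply: eq_bigr => j _; rewrite -[in X in _ * X]As mxE.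
Qed.

Lemma trace_cauchy_schwarz n (A B : 'M[R]_n) : A^T = A -> B^T = B ->
  \tr (A *m B) ^+ 2 <= \tr (A *m A) * \tr (B *m B).
Proof.
move=> As Bs; rewrite -!normF_sqr_sym// !normF_mxvec !norm2_sqr.
suff -> : \tr (A *m B) = dotv (mxvec A)^T (mxvec B)^T by exact: cauchy_schwarz.
rewrite dotv_mxvec; apply: eq_bigr => i _; rewrite mxE.
by apply: eq_bigr => j _; rewrite -[in X in _ * X = _]Bs mxE.
Qed.

(** The Cauchy-Schwarz inequality for the traceless parts of A and B. *)
Lemma trace_covariance_le n (A B : 'M[R]_n) : (0 < n)%N -> A^T = A -> B^T = B ->
  (\tr (A *m B) - \tr A * \tr B / n%:R) ^+ 2 <=
  (\tr (A *m A) - \tr A ^+ 2 / n%:R) * (\tr (B *m B) - \tr B ^+ 2 / n%:R).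
Proof.
move=> n0 As Bs; have nn0 : n%:R != 0 :> R by rewrite pnatr_eq0 -lt0n.
pose Z (C : 'M[R]_n) := C - (\tr C / n%:R)%:M.
have Zs C : C^T = C -> (Z C)^T = Z C.
  by move=> Cs; rewrite /Z linearB/= tr_scalar_mx Cs.
have trZ C D : \tr (Z C *m Z D) = \tr (C *m D) - \tr C * \tr D / n%:R.
  rewrite /Z mulmxBl !mulmxBr mul_scalar_mx mul_mx_scalar -scalar_mxM.
  rewrite !raddfB/= !mxtraceZ mxtrace_scalar -[_ *+ n]mulr_natr.
  by field.
by have := trace_cauchy_schwarz (Zs _ As) (Zs _ Bs); rewrite !trZ !expr2.
Qed.

(** The values of the quadratic form at an eigenbasis are the eigenvalues. *)
Lemma sym_quad_eq0 n (A : 'M[R]_n) : A^T = A ->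
  (forall v : 'cV[R]_n, dotv (A *m v) v = 0) -> A = 0.
Proof.
move=> As A0; have [Q [d [QQ AE]]] := spectral_theorem As.
rewrite AE (_ : d = 0) ?linear0 ?mulmx0 ?mul0mx//; apply/rowP => k.
by rewrite mxE -(diag_congr_eigen d k QQ) -AE.
Qed.
End Frobenius.

Section ScalableFrames.
Variables (R : realType) (N M : nat).
Implicit Types (Phi Psi : 'M[R]_(N, M)) (c : 'I_M -> R).

Lemma scaled_frame_sum Psi (s : 'I_M -> R) x :
  \sum_i `|dotv x (col i (\matrix_(k < N, i < M) (s i * Psi k i)))| ^+ 2 =
  dotv (frame_op Psi (fun i => s i ^+ 2) *m x) x.
Proof.
rewrite frame_op_quad; apply: eq_bigr => i _; rewrite real_normK ?num_real//.
have -> : col i (\matrix_(k < N, i < M) (s i * Psi k i)) = s i *: col i Psi.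
  by apply/colP => k; rewrite !mxE.
by rewrite dotvZr exprMn.
Qed.

(** Scaling by sqrt (c_i) gives a tight frame with bound 1. That Psi itself is a
    frame follows because the coefficients c_i are bounded. *)
Lemma scalable_of_frame_op1 Psi c : (0 < N)%N -> (forall i, 0 <= c i) ->
  frame_op Psi c = 1%:M -> scalable_frames Psi.
Proof.
move=> N0 c0 c1; pose T := 1 + \sum_i c i.
have T0 : 0 < T by rewrite ltr_pwDl// sumr_ge0.
have sum1 i : c i <= T.
  rewrite /T (bigD1 i)//= addrCA lerDl addr_ge0// sumr_ge0//.
split.
  exists T^-1, (T^-1 + \sum_i norm2 (col i Psi) ^+ 2); split.
  - by rewrite invr_gt0.
  - by rewrite lerDl sumr_ge0// => i _; rewrite sqr_ge0.
  move=> x; rewrite norm2_sqr; under eq_bigr do rewrite real_normK ?num_real//.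
  split.
    have -> : dotv x x = \sum_i c i * dotv x (col i Psi) ^+ 2.
      by rewrite -frame_op_quad c1 mul1mx.
    rewrite mulrC ler_pdivrMr// mulr_suml.
    by apply: ler_sum => i _; rewrite mulrC ler_wpM2l ?sqr_ge0.
  rewrite mulrDl -[leLHS]add0r lerD//.
    by rewrite mulr_ge0 ?dotv_ge0// invr_ge0 ltW.
  rewrite mulr_suml; apply: ler_sum => i _.
  by rewrite norm2_sqr mulrC cauchy_schwarz.
exists (fun i => Num.sqrt (c i)); split; first by move=> i; rewrite sqrtr_ge0.
exists 1; split=> // x; rewrite scaled_frame_sum mul1r norm2_sqr.
rewrite (_ : (fun i => _) = c) ?c1 ?mul1mx//.
by apply/funext => i; rewrite sqr_sqrtr.
Qed.

(** Tightness says that the frame operator has the same quadratic form as a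
    multiple of the identity, and the support can then be reduced by
    [frame_op_caratheodory]. *)
Lemma scalable_frame_op1 Psi : scalable_frames Psi ->
  exists c, [/\ forall i, 0 <= c i, frame_op Psi c = 1%:M &
    (#|[pred i | c i != 0%R]| <= minn M (N * N.+1)./2)%N].
Proof.
move=> [_ [s [s0 [a [a0 tight]]]]].
have c0 i : 0 <= a^-1 * s i ^+ 2.
  by rewrite mulr_ge0 ?sqr_ge0// invr_ge0 ltW.
have opPsi1 : frame_op Psi (fun i => a^-1 * s i ^+ 2) = 1%:M.
  rewrite frame_opZ; apply/eqP; rewrite -subr_eq0.
  apply/eqP/sym_quad_eq0.
    by rewrite linearB/= linearZ/= frame_op_sym trmx1.
  move=> v; rewrite mulmxBl mul1mx -scalemxAl dotvDl dotvNl dotvZl.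
  have [t1 t2] := tight v; rewrite -scaled_frame_sum -norm2_sqr.
  rewrite (_ : \sum_i _ = a * norm2 v ^+ 2).
    by rewrite mulrA mulVf ?gt_eqF// mul1r subrr.
  by apply/eqP; rewrite eq_le t1 t2.
have [c [c'0 cE cK]] := frame_op_caratheodory Psi c0.
by exists c; split=> //; rewrite cE.
Qed.
End ScalableFrames.

(** * Bounds for the distance to scalable frames *)

Lemma trace_geo_mean (R : realType) n (X : 'M[R]_n) (h : R) : psd X -> 0 <= h ->
  h ^+ n = \det X -> n%:R * h <= \tr X.
Proof.
move=> /psd_spectral[Q [d [QQ -> d0]]] h0.
rewrite mxtrace_diag_congr// det_diag_congr// -[X in X%:R * _]card_ord => hd.
by apply: geo_mean_le_sum => //; rewrite card_ord.
Qed.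

Section Bounds.
Variables (R : realType) (N M : nat).
Implicit Types (Phi Psi : 'M[R]_(N, M)) (c : 'I_M -> R).
Let K : nat := minn M (N * N.+1)./2.
Let n : R := N%:R.

(** Apply S = P^(-1/2) to the vectors that carry weight and keep the others; the
    frame operator becomes S P S = 1. Only contact points of the ellipsoid carry
    weight, since sum_i c_i (1 - <P^-1 phi_i, phi_i>) = N - N = 0 has nonnegative
    terms, and [inverse_sqrt] bounds the displacement of each of them. *)
Lemma scalable_near Phi c (g : R) : (0 < N)%N -> unit_norm Phi ->
  (forall i, 0 <= c i) -> \sum_i c i = n -> posdef (frame_op Phi c) ->
  (forall i, dotv (invmx (frame_op Phi c) *m col i Phi) (col i Phi) <= 1) ->
  0 < g -> g ^+ N = \det (frame_op Phi c) -> g <= 1 ->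
  exists2 Psi, scalable_frames Psi &
    normF (Phi - Psi) <= Num.sqrt (K%:R * n * (1 - g)).
Proof.
move=> N0 Pu c0 cN Pp q1 g0 gN g1; set P := frame_op Phi c in Pp q1 gN.
have trP : \tr P = n by rewrite mxtrace_frame_op.
have [S [Ss SPS near]] := inverse_sqrt Pp (ltW g0) gN trP.
have [d [d0 dP dK]] := frame_op_caratheodory Phi c0; rewrite -/P in dP.
have dN : \sum_i d i = n by rewrite -(mxtrace_frame_op _ Pu) dP trP.
have contact i : d i != 0 -> dotv (invmx P *m col i Phi) (col i Phi) = 1.
  move=> di; have : \sum_i d i * (1 - dotv (invmx P *m col i Phi) (col i Phi)) = 0.
    under eq_bigr do rewrite mulrBr mulr1.
    rewrite sumrB dN -mxtrace_mul_frame_op dP mulVmx ?posdef_unit// mxtrace_scalar.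
    by rewrite subrr.
  move/eqP; rewrite psumr_eq0 => [/allP H|j _]; last first.
    by rewrite mulr_ge0// subr_ge0.
  have /(_ (mem_index_enum i)) := H i; rewrite mulf_eq0 (negbTE di)/= subr_eq0.
  by move/eqP.
pose Psi := \matrix_(k, i) (if d i != 0 then (S *m Phi) k i else Phi k i).
have PsiE i : col i Psi = if d i != 0 then S *m col i Phi else col i Phi.
  apply/colP => k; rewrite mxE mxE; case: ifP => _; last by rewrite mxE.
  by rewrite !mxE; apply: eq_bigr => j _; rewrite mxE.
exists Psi.
  apply: (@scalable_of_frame_op1 _ _ _ _ d) => //.
  rewrite -[RHS]SPS -dP /frame_op mulmx_sumr mulmx_suml; apply: eq_bigr => i _.
  rewrite PsiE -scalemxAr -scalemxAl; case: ifPn => [_|/negPn/eqP ->].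
    by rewrite trmx_mul Ss !mulmxA.
  by rewrite !scale0r.
have ng0 : 0 <= n * (1 - g) by rewrite mulr_ge0// subr_ge0.
rewrite -[leLHS]ger0_norm ?normF_ge0// -sqrtr_sqr ler_wsqrtr// normF_sqr_cols.
apply: (@le_trans _ _ (\sum_(i | d i != 0) n * (1 - g))).
  rewrite [leRHS]big_mkcond; apply: ler_sum => i _.
  rewrite norm2_sqr linearB/= PsiE; case: ifPn => di.
    by apply: near; exact: contact.
  by rewrite subrr dotv0r.
rewrite sumr_const -[leLHS]mulr_natl -mulrA ler_wpM2r// ler_nat.
exact: dK.
Qed.

Lemma dist_scalable_le Phi Psi : scalable_frames Psi ->
  dist_scalable Phi <= normF (Phi - Psi).
Proof.
move=> sPsi; apply: ge_inf; last by exists Psi.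
by exists 0 => _ [Psi' _ <-]; exact: normF_ge0.
Qed.

Lemma dist_identity_le Phi c : (forall i, 0 <= c i) ->
  dist_identity Phi <= normF (frame_op Phi c - 1%:M).
Proof.
move=> c0; apply: ge_inf; last by exists c.
by exists 0 => _ [c' _ <-]; exact: normF_ge0.
Qed.

Lemma dist_identity_ge0 Phi : 0 <= dist_identity Phi.
Proof.
apply: lb_le_inf; last by move=> _ [c' _ <-]; exact: normF_ge0.
by exists (normF (frame_op Phi (fun=> 0) - 1%:M)), (fun=> 0).
Qed.

Lemma normF_outerB (u w : 'cV[R]_N) :
  normF (u *m u^T - w *m w^T) <= norm2 (u - w) * (norm2 u + norm2 w).
Proof.
have -> : u *m u^T - w *m w^T = u *m (u - w)^T + (u - w) *m w^T.
  by rewrite linearB/= mulmxBr mulmxBl addrA subrK.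
apply: le_trans (normF_triangle _ _) _; rewrite !normF_outer.
by rewrite mulrDr [norm2 u * _]mulrC.
Qed.

(** The Cauchy-Schwarz inequality for the indicator of S and the column norms. *)
Lemma sum_norm_cols_le (A : 'M[R]_(N, M)) (S : {pred 'I_M}) :
  \sum_(i in S) norm2 (col i A) <= Num.sqrt #|S|%:R * normF A.
Proof.
rewrite -ler_sqr ?nnegrE ?sumr_ge0 ?mulr_ge0 ?sqrtr_ge0//; last first.
  by move=> i _; exact: norm2_ge0.
rewrite exprMn sqr_sqrtr// normF_sqr_cols.
pose a : 'cV[R]_M := \col_i (i \in S)%:R.
pose b : 'cV[R]_M := \col_i norm2 (col i A).
have -> : \sum_(i in S) norm2 (col i A) = dotv a b.
  rewrite big_mkcond; apply: eq_bigr => i _; rewrite !mxE.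
  by case: (i \in S); rewrite ?mul1r ?mul0r.
have -> : #|S|%:R = dotv a a.
  rewrite -sum1_card natr_sum big_mkcond; apply: eq_bigr => i _; rewrite !mxE.
  by case: (i \in S); rewrite ?mul1r ?mul0r.
have -> : \sum_j norm2 (col j A) ^+ 2 = dotv b b.
  by apply: eq_bigr => i _; rewrite !mxE expr2.
exact: cauchy_schwarz.
Qed.

(** Use for Phi the weights that turn Psi into a tight frame. The i-th error term
    is at most c_i |phi_i - psi_i| (1 + |psi_i|); here c_i |psi_i|^2 <= 1 because
    the frame operator of Psi is the identity, and |psi_i| >= 1 - e, so that
    c_i (1 + |psi_i|) (1 - e)^2 <= 2. At most K terms occur. *)
Lemma dist_identity_scalable Phi Psi : unit_norm Phi -> scalable_frames Psi ->
  normF (Phi - Psi) < 1 ->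
  dist_identity Phi * (1 - normF (Phi - Psi)) ^+ 2 <=
    2 * Num.sqrt K%:R * normF (Phi - Psi).
Proof.
move=> Pu /scalable_frame_op1[c [c0 c1 cK]]; set e := normF _ => e1.
have e0 : 0 <= e by exact: normF_ge0.
pose r := 1 - e; have r0 : 0 < r by rewrite subr_gt0.
have delta_le i : norm2 (col i (Phi - Psi)) <= e.
  rewrite -ler_sqr ?nnegrE ?norm2_ge0// normF_sqr_cols (bigD1 i)//= lerDl.
  by rewrite sumr_ge0// => j _; exact: sqr_ge0.
have psi_ge i : r <= norm2 (col i Psi).
  have := norm2_triangle (col i Psi) (col i (Phi - Psi)).
  have -> : col i Psi + col i (Phi - Psi) = col i Phi by rewrite linearB/= addrC subrK.
  by rewrite Pu /r; have := delta_le i; lra.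
have c_le i : c i * norm2 (col i Psi) ^+ 2 <= 1.
  have p0 : 0 < norm2 (col i Psi) ^+ 2 by rewrite exprn_gt0// (lt_le_trans r0).
  rewrite -(ler_pM2r p0) mul1r -mulrA -expr2 [leRHS]norm2_sqr.
  rewrite -[X in _ <= dotv X _]mul1mx -c1 frame_op_quad (bigD1 i)//= -norm2_sqr lerDl.
  by rewrite sumr_ge0// => j _; rewrite mulr_ge0 ?sqr_ge0.
have term i : c i * normF (col i Phi *m (col i Phi)^T - col i Psi *m (col i Psi)^T)
    * r ^+ 2 <= 2 * norm2 (col i (Phi - Psi)).
  have := normF_outerB (col i Phi) (col i Psi); rewrite Pu -linearB/=.
  have := c_le i; have := psi_ge i; have := norm2_ge0 (col i (Phi - Psi)).
  move: (norm2 (col i Psi)) (norm2 _) (normF _) (c0 i).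
  move=> p de f ci0 de0 rp cp fle.
  have r1 : r <= 1 by rewrite /r; lra.
  have p0 : 0 < p by lra.
  have crp : c i * (1 + p) * r ^+ 2 <= 2.
    have h1 : c i * r ^+ 2 <= c i * p ^+ 2.
      by rewrite ler_wpM2l// lerXn2r// nnegrE ltW.
    have h2 : c i * p * r ^+ 2 <= c i * p ^+ 2.
      rewrite -mulrA ler_wpM2l// [in leRHS]expr2 ler_wpM2l ?(ltW p0)//.
      by apply: le_trans rp; rewrite expr2 ler_piMl// ltW.
    by lra.
  have h3 : c i * f * r ^+ 2 <= c i * (de * (1 + p)) * r ^+ 2.
    by rewrite ler_wpM2r ?sqr_ge0// ler_wpM2l.
  apply: le_trans h3 _.
  have -> : c i * (de * (1 + p)) * r ^+ 2 = (c i * (1 + p) * r ^+ 2) * de by ring.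
  by rewrite ler_wpM2r.
have D_le : dist_identity Phi <= \sum_(i | c i != 0)
    c i * normF (col i Phi *m (col i Phi)^T - col i Psi *m (col i Psi)^T).
  apply: le_trans (dist_identity_le Phi c0) _; rewrite -c1 /frame_op -sumrB.
  apply: le_trans (normF_sum _) _; rewrite [leRHS]big_mkcond.
  apply: ler_sum => i _; rewrite -scalerBr normFZ (ger0_norm (c0 i)).
  by case: ifPn => // /negPn/eqP ->; rewrite mul0r.
apply: (@le_trans _ _ (\sum_(i | c i != 0) 2 * norm2 (col i (Phi - Psi)))).
  apply: le_trans (ler_wpM2r (sqr_ge0 _) D_le) _; rewrite mulr_suml.
  by apply: ler_sum => i _; exact: term.
rewrite -mulr_sumr -mulrA ler_wpM2l//.
apply: le_trans (sum_norm_cols_le _ [pred i | c i != 0]) _.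
by rewrite ler_wpM2r// ler_wsqrtr// ler_nat.
Qed.
End Bounds.

(** Clearing the denominator and squaring away the root turns the conclusion into
    x (1 - e)^2 <= 2 k e when e < 1, while for e >= 1 the fraction is below 1
    anyway. Allowing any x below D covers both D and the expression delta in
    the volume ratio. *)
Lemma lower_fraction_le (R : rcfType) (D x k e : R) : 0 <= x -> x <= D -> 0 < k ->
  0 <= e -> (e < 1 -> D * (1 - e) ^+ 2 <= 2 * k * e) ->
  x / (x + k + Num.sqrt ((x + k) ^+ 2 - x ^+ 2)) <= e.
Proof.
move=> x0 xD k0 e0 H; set w := Num.sqrt _.
have w0 : 0 <= w by exact: sqrtr_ge0.
have w2 : w ^+ 2 = k ^+ 2 + 2 * x * k.
  have -> : k ^+ 2 + 2 * x * k = (x + k) ^+ 2 - x ^+ 2 by ring.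
  rewrite sqr_sqrtr// (_ : _ - _ = k ^+ 2 + 2 * x * k); last by ring.
  by rewrite addr_ge0 ?sqr_ge0// !mulr_ge0// ltW.
rewrite ler_pdivrMr; last by lra.
have [e1|e1] := leP 1 e; first by nra.
have {}H : x * (1 - e) ^+ 2 <= 2 * k * e.
  by apply: le_trans (H e1); rewrite ler_wpM2r ?sqr_ge0.
suff : x * (1 - e) - e * k <= e * w by lra.
have [|pos] := leP (x * (1 - e) - e * k) 0.
  by move/le_trans; apply; rewrite mulr_ge0.
rewrite -ler_sqr ?nnegrE ?(ltW pos) ?mulr_ge0// exprMn w2 -subr_ge0.
have -> : e ^+ 2 * (k ^+ 2 + 2 * x * k) - (x * (1 - e) - e * k) ^+ 2 =
  x * (2 * k * e - x * (1 - e) ^+ 2) by ring.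
by rewrite mulr_ge0// subr_ge0.
Qed.

(** * Distance to the identity and volume ratio *)

(** For A = e2 (n - 1) and B = n - e2 the hypothesis reads
    A h^2 <= A x^2 - B (x - 1)^2, and the maximum of the right-hand side over x
    is A B / (B - A), where B - A = n (1 - e2). If A = 0 the hypothesis forces
    x = 1 and h <= x is used instead. *)
Lemma ratio_algebra (R : realFieldType) (n e2 x h g : R) :
  1 <= n -> 0 <= e2 -> e2 < 1 -> 0 < g -> h * g = 1 -> h <= x ->
  (x - 1) ^+ 2 * (n - e2) <= e2 * (n - 1) * (x ^+ 2 - h ^+ 2) ->
  n * (1 - e2) <= g ^+ 2 * (n - e2).
Proof.
move=> n1 e0 e1 g0 hg hx key.
have h0 : 0 < h by rewrite -(pmulr_lgt0 _ g0) hg.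
pose A := e2 * (n - 1); pose B := n - e2.
have A0 : 0 <= A by rewrite mulr_ge0// subr_ge0.
have B0 : 0 < B by rewrite /B; lra.
have BA : B - A = n * (1 - e2) by rewrite /A /B; ring.
have C0 : 0 < B - A by rewrite BA mulr_gt0//; lra.
rewrite -BA -/B.
suff hB : h ^+ 2 * (B - A) <= B.
  have : g ^+ 2 * (h ^+ 2 * (B - A)) <= g ^+ 2 * B by rewrite ler_wpM2l ?sqr_ge0.
  by rewrite mulrA -exprMn (mulrC g) hg expr1n mul1r.
move: key; rewrite -/A -/B => key.
have [A00|A_neq0] := eqVneq A 0.
  rewrite A00 mul0r in key.
  have x1 : x = 1.
    apply/eqP; rewrite -subr_eq0 -sqrf_eq0 eq_le sqr_ge0 andbT.
    by rewrite -(pmulr_lle0 _ B0).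
  rewrite A00 subr0 ler_piMl ?(ltW B0)//.
  by rewrite -[leRHS](expr1n _ 2) lerXn2r ?nnegrE ?(ltW h0)// -x1.
have Apos : 0 < A by rewrite lt_def A_neq0.
rewrite -(ler_pM2l Apos).
have H1 : (B - A) * ((x - 1) ^+ 2 * B) <= (B - A) * (A * (x ^+ 2 - h ^+ 2)).
  by rewrite ler_wpM2l// ltW.
have H2 : 0 <= ((B - A) * x - B) ^+ 2 by exact: sqr_ge0.
rewrite -subr_ge0; rewrite -subr_ge0 in H1.
rewrite (_ : A * B - A * (h ^+ 2 * (B - A)) =
  ((B - A) * x - B) ^+ 2 + ((B - A) * (A * (x ^+ 2 - h ^+ 2)) -
    (B - A) * ((x - 1) ^+ 2 * B))); last by ring.
by rewrite addr_ge0.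
Qed.

Section Ratio.
Variables (R : realType) (N M : nat).
Implicit Types (Phi Psi : 'M[R]_(N, M)) (c : 'I_M -> R).

(** Let x be the mean eigenvalue of X, t = tr Q and tau = tr (Q^2). The hypothesis
    tr (X Q) <= t says that the traceless parts of X and Q have inner product at
    most - t (x - 1), so the Cauchy-Schwarz inequality bounds t^2 (x - 1)^2 by the
    product of their squared norms. Maclaurin's inequality bounds the first by
    N (N - 1) (x^2 - h^2); the second, tau - t^2 / N, is at most
    t^2 e2 / (N (N - e2)) because (t - tau)^2 >= 0. *)
Lemma mean_excess_le (X Q : 'M[R]_N) (e2 h : R) : (0 < N)%N ->
  posdef X -> Q^T = Q -> h ^+ N = \det X -> 1 <= h ->
  \tr (X *m Q) <= \tr Q -> 0 <= \tr Q ->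
  e2 = \tr (Q *m Q) - 2 * \tr Q + N%:R -> e2 < 1 ->
  (\tr X / N%:R - 1) ^+ 2 * (N%:R - e2) <=
    e2 * (N%:R - 1) * ((\tr X / N%:R) ^+ 2 - h ^+ 2).
Proof.
move=> N0 Xp Qs hN h1 trXQ t0 e2E e1.
have n1 : 1 <= N%:R :> R by rewrite ler1n.
have h0 : 0 <= h by exact: le_trans ler01 h1.
have := trace_covariance_le N0 (proj1 Xp) Qs.
have tauv : \tr Q ^+ 2 <= N%:R * \tr (Q *m Q).
  have := trace_cauchy_schwarz (trmx1 _ _) Qs.
  by rewrite !mul1mx mxtrace_scalar.
have := trace_pairs (posdef_psd Xp) h0 hN.
have := trace_geo_mean (posdef_psd Xp) h0 hN.
have tau0 : 0 <= \tr (Q *m Q) by rewrite -normF_sqr_sym// sqr_ge0.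
have [tau00|tau_neq0] := eqVneq (\tr Q) 0; first by exfalso; clear Qs Xp hN; lra.
have tpos : 0 < \tr Q by rewrite lt_def tau_neq0.
move: (\tr (X *m Q)) (\tr (X *m X)) (\tr (Q *m Q)) (\tr X) (\tr Q) (N%:R : R)
  n1 tau0 tauv trXQ t0 e2E tpos {tau_neq0}.
move=> xq xx tau a t n n1 tau0 tauv trXQ t0 e2E tpos geo pairs cs.
have n0 : 0 < n by lra.
pose x := a / n; have aE : a = n * x by rewrite mulrC divfK// gt_eqF.
have hx : h <= x by rewrite ler_pdivlMr// mulrC.
have x1 : 0 <= x - 1 by lra.
rewrite -/x; move: pairs geo cs; rewrite aE => pairs _.
have -> : xq - n * x * t / n = xq - x * t by field; rewrite gt_eqF.
have -> : xx - (n * x) ^+ 2 / n = xx - n * x ^+ 2 by field; rewrite gt_eqF.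
move=> cs.
have e2n : 0 < n - e2 by lra.
have s1 : (t * (x - 1)) ^+ 2 <= (xq - x * t) ^+ 2.
  rewrite -[leRHS]sqrrN lerXn2r ?nnegrE ?mulr_ge0//; last by lra.
  by apply: (@le_trans _ _ (t * (x - 1))); [rewrite mulr_ge0|lra].
have s2 : xx - n * x ^+ 2 <= n * (n - 1) * (x ^+ 2 - h ^+ 2) by lra.
have s3 : (tau - t ^+ 2 / n) * (n * (n - e2)) <= t ^+ 2 * e2.
  have -> : (tau - t ^+ 2 / n) * (n * (n - e2)) =
      t ^+ 2 * e2 - n * (t - tau) ^+ 2.
    by rewrite e2E; field; rewrite gt_eqF.
  by rewrite gerBl mulr_ge0 ?sqr_ge0// ltW.
have s4 : 0 <= n * (n - 1) * (x ^+ 2 - h ^+ 2).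
  rewrite mulr_ge0//; first by rewrite mulr_ge0 ?subr_ge0// ltW.
  by rewrite subr_ge0 lerXn2r ?nnegrE//; lra.
have nn0 : 0 < n * (n - e2) by rewrite mulr_gt0.
have s5 : (xx - n * x ^+ 2) * (tau - t ^+ 2 / n) * (n * (n - e2)) <=
    n * (n - 1) * (x ^+ 2 - h ^+ 2) * (t ^+ 2 * e2).
  have tp : 0 <= tau - t ^+ 2 / n by rewrite subr_ge0 ler_pdivrMr// mulrC.
  rewrite -mulrA; apply: (@le_trans _ _
    (n * (n - 1) * (x ^+ 2 - h ^+ 2) * ((tau - t ^+ 2 / n) * (n * (n - e2))))).
    by rewrite ler_wpM2r// mulr_ge0// ltW.
  by rewrite ler_wpM2l.
have tn0 : 0 < t ^+ 2 * n by rewrite mulr_gt0 ?exprn_gt0.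
rewrite -(ler_pM2l tn0).
have -> : t ^+ 2 * n * ((x - 1) ^+ 2 * (n - e2)) =
    (t * (x - 1)) ^+ 2 * (n * (n - e2)) by ring.
have -> : t ^+ 2 * n * (e2 * (n - 1) * (x ^+ 2 - h ^+ 2)) =
    n * (n - 1) * (x ^+ 2 - h ^+ 2) * (t ^+ 2 * e2) by ring.
apply: le_trans s5; rewrite ler_wpM2r ?(ltW nn0)//.
exact: le_trans s1 cs.
Qed.

(** Take X = P^-1 and Q = frame_op Phi b in [mean_excess_le]: since
    <X phi_i, phi_i> <= 1 for all i, every frame operator satisfies
    tr (X Q) <= tr Q. *)
Lemma det_bound_of_identity_gap Phi c b (g : R) : (0 < N)%N -> unit_norm Phi ->
  posdef (frame_op Phi c) ->
  (forall i, dotv (invmx (frame_op Phi c) *m col i Phi) (col i Phi) <= 1) ->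
  0 < g -> g ^+ N = \det (frame_op Phi c) -> g <= 1 ->
  (forall i, 0 <= b i) -> normF (frame_op Phi b - 1%:M) < 1 ->
  N%:R * (1 - normF (frame_op Phi b - 1%:M) ^+ 2) <=
    g ^+ 2 * (N%:R - normF (frame_op Phi b - 1%:M) ^+ 2).
Proof.
move=> N0 Pu Pp q1 g0 gN g1 b0 e1; set e := normF _ in e1 *.
set Q := frame_op Phi b in e e1 *; have Qs : Q^T = Q by exact: frame_op_sym.
have e0 : 0 <= e by exact: normF_ge0.
have n1 : 1 <= N%:R :> R by rewrite ler1n.
have Xp := posdef_inv Pp.
have hN : g^-1 ^+ N = \det (invmx (frame_op Phi c)) by rewrite exprVn gN det_inv.
have h1 : 1 <= g^-1 by rewrite invf_ge1.
have e21 : e ^+ 2 < 1 by rewrite expr_lt1.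
have trQ0 : 0 <= \tr Q by rewrite mxtrace_frame_op// sumr_ge0.
apply: (@ratio_algebra _ _ _ (\tr (invmx (frame_op Phi c)) / N%:R) g^-1) => //.
- exact: sqr_ge0.
- by rewrite mulVf// gt_eqF.
- rewrite ler_pdivlMr ?ltr0n// mulrC.
  by apply: trace_geo_mean => //; [exact: posdef_psd|rewrite invr_ge0 ltW].
apply: (@mean_excess_le _ Q) => //.
- rewrite mxtrace_mul_frame_op mxtrace_frame_op//; apply: ler_sum => i _.
  by rewrite -[leRHS]mulr1 ler_wpM2l.
- rewrite normF_sqr_sym; last by rewrite linearB/= Qs trmx1.
  rewrite mulmxBl !mulmxBr !mulmx1 !mul1mx !raddfB/= mxtrace_scalar.
  by ring.
Qed.
End Ratio.

(** The map y |-> n (1 - y) / (n - y) is a decreasing involution, so the hypothesis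
    on g^2 can be solved for e^2. If n = g = 1 the fraction is 0, being a division
    by 0; for e >= 1 it is enough that the fraction is at most 1. *)
Lemma ratio_sqrt_le (R : rcfType) (n g e : R) : 1 <= n -> 0 < g -> g <= 1 ->
  0 <= e -> (e < 1 -> n * (1 - e ^+ 2) <= g ^+ 2 * (n - e ^+ 2)) ->
  Num.sqrt (n * (1 - g ^+ 2) / (n - g ^+ 2)) <= e.
Proof.
move=> n1 g0 g1 e0 H; rewrite -[leRHS]ger0_norm// -sqrtr_sqr ler_wsqrtr//.
have g2 : g ^+ 2 <= 1 by rewrite expr_le1// ltW.
have [->|ng] := eqVneq (n - g ^+ 2) 0; first by rewrite invr0 mulr0 sqr_ge0.
rewrite ler_pdivrMr; last by rewrite lt_def ng/=; lra.
have [e1|/H] := leP 1 e; last by lra.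
have E1 : 1 <= e ^+ 2 by rewrite expr_ge1.
have H1 : 0 <= (e ^+ 2 - 1) * (n - g ^+ 2) by rewrite mulr_ge0 ?subr_ge0//; lra.
have H2 : 0 <= (n - 1) * g ^+ 2 by rewrite mulr_ge0 ?subr_ge0 ?sqr_ge0.
by lra.
Qed.

(** * The theorem *)

Theorem theorem3p4 (R : realType) (N M : nat) (Phi : 'M[R]_(N, M))
    (N_gt0 : (0 < N)%N) (Phi_frame : is_frame Phi) (Phi_unit : unit_norm Phi)
    (d_lt1 : dist_scalable Phi < 1) :
  let d := dist_scalable Phi in
  let D := dist_identity Phi in
  let V := ellipsoid_ratio Phi in
  let K := (minn M (N * N.+1)./2)%:R : R in
  let n := N%:R : R in
  let omega := D + Num.sqrt K in
  (* the consequences of the inequalities between D and V *)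
  let delta := Num.sqrt (n * (1 - V `^ (4 / n)) / (n - V `^ (4 / n))) in
  let omegaV := delta + Num.sqrt K in
  [/\ D / (omega + Num.sqrt (omega ^+ 2 - D ^+ 2)) <= d,
      d <= Num.sqrt (K * n * (1 - V `^ (2 / n))),
      d <= Num.sqrt (K * n *
             (1 - Num.sqrt (n * Num.max 0 (1 - D ^+ 2) / (n - D ^+ 2)))) &
      delta / (omegaV + Num.sqrt (omegaV ^+ 2 - delta ^+ 2)) <= d].
Proof.
move=> d D V K n omega delta omegaV.
have [c [c0 cN Pp q1]] := optimal_design N_gt0 Phi_frame Phi_unit.
have P0 := posdef_det_gt0 Pp.
have [g0 gN V4] := ellipsoid_ratio_geo_mean N_gt0 P0 (ellipsoid_ratioE c0 cN Pp q1).
rewrite -/V -/n in g0 gN V4.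
(* From here on g = V^(2/N), the geometric mean of the eigenvalues of the optimal
   frame operator. *)
rewrite /omegaV /delta V4 {omegaV delta V4}.
move: (V `^ (2 / n)) g0 gN => g g0 gN.
have n1 : 1 <= n by rewrite ler1n.
have g1 : g <= 1.
  have tr1 : \tr (1%:M *m frame_op Phi c) <= N%:R.
    by rewrite mul1mx mxtrace_frame_op// cN.
  have := psd_det_mul_le (posdef_psd (posdef1 _ _)) (posdef_psd Pp) tr1.
  rewrite det1 mul1r -gN -[leRHS](expr1n _ N) ler_pXn2r// ?nnegrE ltW//.
have [Psi sPsi nearPsi] := scalable_near N_gt0 Phi_unit c0 cN Pp q1 g0 gN g1.
have D0 : 0 <= D := dist_identity_ge0 Phi.
have M0 : (0 < M)%N.
  rewrite lt0n; apply/eqP => M0; have : n = 0.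
    by rewrite /n -cN big1// => -[i iM]; exfalso; rewrite M0 in iM.
  by lra.
have K0 : 0 < Num.sqrt K.
  rewrite sqrtr_gt0 ltr0n leq_min M0/= half_gt0.
  by case: (N) N_gt0 => // m _; rewrite mulSn !addSn.
pose delta := Num.sqrt (n * (1 - g ^+ 2) / (n - g ^+ 2)).
have deltaD : delta <= D.
  apply: lb_le_inf.
    by exists (normF (frame_op Phi (fun=> 0) - 1%:M)), (fun=> 0).
  move=> _ [b b0 <-]; apply: ratio_sqrt_le => //; first exact: normF_ge0.
  exact: det_bound_of_identity_gap N_gt0 Phi_unit Pp q1 g0 gN g1 b0.
have lower x : 0 <= x -> x <= D ->
    x / (x + Num.sqrt K + Num.sqrt ((x + Num.sqrt K) ^+ 2 - x ^+ 2)) <= d.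
  move=> x0 xD; apply: lb_le_inf; first by exists (normF (Phi - Psi)), Psi.
  move=> _ [Psi' sPsi' <-].
  apply: (lower_fraction_le x0 xD K0 (normF_ge0 _)) => e1.
  exact: dist_identity_scalable.
have upper : d <= Num.sqrt (K * n * (1 - g)).
  exact: le_trans (dist_scalable_le Phi sPsi) nearPsi.
split; [exact: lower|exact: upper| |exact/lower/deltaD/sqrtr_ge0].
apply: le_trans upper _; rewrite ler_wsqrtr// ler_wpM2l//.
  by rewrite mulr_ge0// ?ler0n.
rewrite lerD2l lerN2 -[leRHS](ger0_norm (ltW g0)) -sqrtr_sqr ler_wsqrtr//.
have [D1|D1] := leP 1 D.
  by rewrite max_l ?mulr0 ?mul0r ?sqr_ge0// subr_le0 expr_ge1.
have D2 : D ^+ 2 < 1 by rewrite expr_lt1.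
rewrite max_r ?subr_ge0 ?(ltW D2)// ler_pdivrMr; last by lra.
have g2 : g ^+ 2 <= 1 by rewrite expr_le1// ltW.
(* This is delta <= D with the square root and the denominator cleared. *)
suff : n * (1 - g ^+ 2) <= D ^+ 2 * (n - g ^+ 2) by lra.
have [ng|ng] := eqVneq (n - g ^+ 2) 0; first by rewrite ng; nra.
have ng0 : 0 < n - g ^+ 2 by rewrite lt_def ng/=; lra.
rewrite -ler_pdivrMr// -[leLHS]sqr_sqrtr; last first.
  by rewrite mulr_ge0 ?invr_ge0 ?(ltW ng0)// mulr_ge0 ?subr_ge0//; lra.
by rewrite lerXn2r ?nnegrE ?sqrtr_ge0.
Qed.
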